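(* Let $\Omega\subset\mathbb{R}^n$ be an open convex set with finite inradius $\delta_0=\delta_0(\Omega)$. Let $p\ge 1$ and $g\in C_0^1(\Omega)$. (i) If $m>1$, $\nu\in[0,1/m]$ and $\lambda\in\left[0,\frac{1+\nu m}{2}\right)$, then $$(1-p\nu^2 m^2)\int_\Omega \frac{|g(x)|^p}{\delta(x)^2}\,dx+\frac{4p\left(c_\nu^2(m)+(m-1)(\lambda-\lambda^2)\right)}{\delta_0^m}\int_\Omega \frac{|g(x)|^p}{\delta(x)^{2-m}}\,dx\le p^p\left(2(1+\nu m)-4\lambda^2\right)^p\int_\Omega\frac{|\nabla g(x)|^p}{\delta(x)^{2-p}}\,dx.$$ (ii) If $m>1$, $\nu\in[0,1/m)$ and $\lambda\in\left[0,\frac{1+\nu m}{2}\right)$, then $$\int_\Omega \frac{|g(x)|^p}{\delta(x)^2}\,dx+\frac{4p\left(c_\nu^2(m)+(m-1)(\lambda-\lambda^2)\right)}{(1-\nu^2m^2)\,\delta_0^m}\int_\Omega \frac{|g(x)|^p}{\delta(x)^{2-m}}\,dx\le p^p\left(\frac{2}{1-\nu m}-\frac{4\lambda^2}{1-\nu^2m^2}\right)^p\int_\Omega\frac{|\nabla g(x)|^p}{\delta(x)^{2-p}}\,dx.$$ Here $c_\nu(m)$ (which depends on $\lambda$) is the number satisfying $$(1-2\lambda)J_\nu\left(\tfrac{2}{m}c_\nu(m)\right)+2c_\nu(m)J_\nu'\left(\tfrac{2}{m}c_\nu(m)\right)=0\quad\text{and}\quad \tfrac{2}{m}c_\nu(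m)\in(0,j_\nu).$$
   Context: $J_\nu$ is the Bessel function of the first kind of order $\nu$, $J_\nu'$ its derivative, and $j_\nu$ the first positive zero of $J_\nu$; $c_\nu(m)$ is taken to be the first such root. For an open set $\Omega$, $\delta(x)=\operatorname{dist}(x,\partial\Omega)$ and the inradius is $\delta_0(\Omega)=\sup_{x\in\Omega}\delta(x)$. $C_0^1(\Omega)$ is the family of continuously differentiable functions $\Omega\to\mathbb{R}$ with compact support in $\Omega$. *)

(* Defs.v *)
From HB Require Import structures.
From mathcomp Require Import all_boot all_order all_algebra.
From mathcomp Require Import all_classical all_reals all_analysis.

Set Implicit Arguments.
Unset Strict Implicit.
Unset Printing Implicit Defensive.

Import Order.TTheory GRing.Theory Num.Theory.
Import numFieldNormedType.Exports.

Local Open Scope classical_set_scope.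
Local Open Scope ring_scope.

(* The Borel sigma-algebra of R^n, presented as the sigma-algebra generated by
   the coordinates. *)
Definition rV_display : measure_display.
Proof. exact: default_measure_display. Qed.

Section rV_measurable.
Variables (R : realType) (n : nat).

Let coord (i : 'I_n) (x : 'rV[R]_n) : measurableTypeR R := x ord0 i.

Let rV_set0 : g_sigma_preimage coord set0.
Proof. exact: sigma_algebra0. Qed.

Let rV_setC A : g_sigma_preimage coord A -> g_sigma_preimage coord (~` A).
Proof. exact: sigma_algebraC. Qed.

Let rV_bigcup (F : (set 'rV[R]_n)^nat) :
  (forall i, g_sigma_preimage coord (F i)) ->
  g_sigma_preimage coord (\bigcup_i (F i)).
Proof. exact: sigma_algebra_bigcup. Qed.

HB.instance Definition _ := @isMeasurable.Build rV_display
  'rV[R]_n (g_sigma_preimage coord) rV_set0 rV_setC rV_bigcup.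

End rV_measurable.

Section rV_cons.
Variables (R : realType).

Lemma measurable_rV_coord n (i : 'I_n) :
  measurable_fun setT ((fun x => x ord0 i) : 'rV[R]_n -> measurableTypeR R).
Proof.
move=> _ Y mY; rewrite setTI; apply: sub_sigma_algebra => /=.
rewrite -bigcup_seq/=; exists i => /=; first by rewrite mem_index_enum.
by exists Y => //; rewrite setTI.
Qed.

Lemma measurable_fun_rV d (T : measurableType d) n (f : T -> 'rV[R]_n) :
  (forall i, measurable_fun setT ((fun x => f x ord0 i) : T -> measurableTypeR R)) ->
  measurable_fun setT f.
Proof.
move=> mf _ A mA; rewrite setTI.
pose C : set_system 'rV[R]_n := [set A | measurable (f @^-1` A)].
suff : C A by [].
have sC : sigma_algebra setT C.
  split; first by rewrite /C /= preimage_set0; exact: measurable0.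
  - by move=> B CB; rewrite /C /= setTD preimage_setC; exact: measurableC.
  - move=> F CF; rewrite /C /= preimage_bigcup.
    by apply: bigcupT_measurable.
apply: mA; split => //.
rewrite -bigcup_seq => B [i _ /= [Y mY <-]].
have := mf i measurableT Y mY.
by rewrite /C /= !setTI.
Qed.

Definition rV_cons n (z : measurableTypeR R * 'rV[R]_n) : 'rV[R]_n.+1 :=
  row_mx (const_mx z.1 : 'rV_1) z.2.

Definition rV_uncons n (x : 'rV[R]_n.+1) : measurableTypeR R * 'rV[R]_n :=
  (x ord0 ord0, \row_i x ord0 (lift ord0 i)).

Lemma rV_consK n : cancel (@rV_cons n) (@rV_uncons n).
Proof.
move=> [t v]; rewrite /rV_uncons /rV_cons; congr pair.
  rewrite mxE; case: splitP => [j _|k /=]; first by rewrite mxE.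
  by rewrite add1n.
apply/rowP => i; rewrite !mxE; case: splitP => [j|k].
  by rewrite lift0 => /eqP; rewrite (ord1 j).
by rewrite lift0 add1n => -[] /val_inj ->.
Qed.

Lemma measurable_rV_cons n : measurable_fun setT (@rV_cons n).
Proof.
apply: measurable_fun_rV => i.
case: (unliftP ord0 i) => [j ->|->].
- rewrite (_ : (fun _ => _) = (fun x : 'rV[R]_n => x ord0 j : measurableTypeR R) \o snd).
    by apply: measurableT_comp => //; exact: measurable_rV_coord.
  apply/funext => z /=; have := rV_consK z; rewrite /rV_uncons.
  by move=> /(congr1 snd)/rowP/(_ j) /=; rewrite mxE.
- rewrite (_ : (fun _ => _) = fst) //.
  apply/funext => z /=; have := rV_consK z; rewrite /rV_uncons.
  by move=> /(congr1 fst).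
Qed.

Lemma measurable_rV_uncons n : measurable_fun setT (@rV_uncons n).
Proof.
apply/measurable_fun_pair => /=; first exact: measurable_rV_coord.
apply: measurable_fun_rV => i.
rewrite (_ : (fun _ => _) = (fun x : 'rV[R]_n.+1 => x ord0 (lift ord0 i))).
  exact: measurable_rV_coord.
by apply/funext => x; rewrite mxE.
Qed.

End rV_cons.

Section lebesgue_rV_step.
Variables (R : realType) (n : nat).
Variable mu : {sigma_finite_measure set 'rV[R]_n -> \bar R}.

Definition lebesgue_rV_step : set 'rV[R]_n.+1 -> \bar R :=
  pushforward (lebesgue_measure \x mu)%E (@rV_cons R n).

Let m : {measure set 'rV[R]_n.+1 -> \bar R} :=
  measure_function_pushforward__canonical__measure_function_Measure
    (lebesgue_measure \x mu)%E (@measurable_rV_cons R n).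

HB.instance Definition _ := isMeasure.Build _ _ _ lebesgue_rV_step
  (measure0 m) (measure_ge0 m) (@measure_semi_sigma_additive _ _ _ m).

Let lebesgue_rV_step_sigma_finite : sigma_finite setT lebesgue_rV_step.
Proof.
have /sigma_finiteP[F [TF ndF Foo]] := sigma_finiteT (@lebesgue_measure R).
have /sigma_finiteP[G [TG ndG Goo]] := sigma_finiteT mu.
exists (fun k => @rV_uncons R n @^-1` (F k `*` G k)).
  rewrite -preimage_bigcup (_ : \bigcup_k (F k `*` G k) = setT) ?preimage_setT//.
  apply/seteqP; split => // -[x y] _.
  have [i _ Fx] : (\bigcup_i F i) x by rewrite -TF.
  have [k _ Gy] : (\bigcup_i G i) y by rewrite -TG.
  exists (maxn i k) => //; split => /=.
    by move: x Fx; exact/subsetPset/ndF/leq_maxl.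
  by move: y Gy; exact/subsetPset/ndG/leq_maxr.
move=> k; have [mF Fk] := Foo k; have [mG Gk] := Goo k; split.
  rewrite -[X in measurable X]setTI.
  by apply: measurable_rV_uncons => //; exact: measurableX.
rewrite /lebesgue_rV_step /pushforward -comp_preimage.
rewrite (_ : _ \o _ = id); last by apply/funext => z; exact: rV_consK.
by rewrite preimage_id product_measure1E// lte_mul_pinfty// ge0_fin_numE.
Qed.

HB.instance Definition _ := Measure_isSigmaFinite.Build _ _ _ lebesgue_rV_step
  lebesgue_rV_step_sigma_finite.

End lebesgue_rV_step.

(* n-dimensional Lebesgue measure, as the n-fold product of the one-dimensional
   one; lebesgue_rV_box below characterizes it. *)
Fixpoint lebesgue_rV (R : realType) (n : nat) :
    {sigma_finite_measure set 'rV[R]_n -> \bar R} :=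
  match n with
  | 0 => dirac (0 : 'rV[R]_0)
  | n'.+1 => lebesgue_rV_step (lebesgue_rV R n')
  end.

Lemma lebesgue_rV_box (R : realType) (n : nat)
    (A : 'I_n -> set (measurableTypeR R)) :
  (forall i, measurable (A i)) ->
  lebesgue_rV R n [set x | forall i, A i (x ord0 i)] =
  (\prod_(i < n) lebesgue_measure (A i))%E.
Proof.
elim: n A => [|n IH] A mA.
  rewrite big_ord0 /= diracE mem_set//=.
  by move=> [].
have mbox : measurable [set x : 'rV[R]_n | forall i, A (lift ord0 i) (x ord0 i)].
  rewrite (_ : [set x | _] = \bigcap_(i in [set: 'I_n])
      ((fun x : 'rV[R]_n => x ord0 i : measurableTypeR R) @^-1` A (lift ord0 i))).
    apply: fin_bigcap_measurable => // i _.
    by rewrite -[X in measurable X]setTI; exact: measurable_rV_coord.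
  by apply/seteqP; split => x /= Ax i => [_|]; exact: Ax.
rewrite big_ord_recl -IH//.
rewrite /= /lebesgue_rV_step /pushforward -product_measure1E//.
congr (_ _); apply/seteqP; split => [[t v]|[t v]] /=.
- move=> H; have /(congr1 fst)/= ht := rV_consK (t, v).
  have /(congr1 snd)/= hv := rV_consK (t, v); split; first by rewrite -ht; exact: H.
  by move=> i; rewrite -hv mxE; exact: H.
- move=> [At Av] i.
  have /(congr1 fst)/= ht := rV_consK (t, v).
  have /(congr1 snd)/rowP/= hv := rV_consK (t, v).
  case: (unliftP ord0 i) => [j ->|->]; last by rewrite ht.
  by have := hv j; rewrite mxE => ->; exact: Av.
Qed.

Section convex_domain.
Variables (R : realType) (n : nat).
Implicit Types (Omega : set 'rV[R]_n) (g : 'rV[R]_n -> R) (x : 'rV[R]_n).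

(* The library norm on 'rV[R]_n is the sup norm, hence the separate definition;
   the two norms induce the same topology. *)
Definition enorm x : R := Num.sqrt (\sum_(i < n) x ord0 i ^+ 2).

Definition boundary Omega : set 'rV[R]_n := closure Omega `\` interior Omega.

(* Extended-real valued, so that the inradius is +oo when Omega is the whole
   space (empty boundary) and -oo when Omega is empty; its finiteness excludes
   both cases, and n = 0 with them. *)
Definition edelta Omega x : \bar R :=
  ereal_inf [set (enorm (x - y))%:E | y in boundary Omega].

Definition einradius Omega : \bar R := ereal_sup [set edelta Omega x | x in Omega].

Definition delta Omega x : R := fine (edelta Omega x).

Definition inradius Omega : R := fine (einradius Omega).

Definition grad g x : 'rV[R]_n := \row_i 'D_(delta_mx ord0 i) g x.

(* Functions on Omega are represented by total functions whose values outside
   Omega play no role. *)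
Definition C1_on Omega g :=
  forall x, Omega x -> differentiable g x /\ {for x, continuous (grad g)}.

Definition C01 Omega g :=
  let supp := closure (Omega `&` [set x | g x != 0]) in
  [/\ C1_on Omega g, compact supp & supp `<=` Omega].

End convex_domain.

Section bessel.
Variable R : realType.
Implicit Types (nu m lambda s x : R).

(* Euler's integral, for s > 0 *)
Definition Gamma s : R :=
  \int[@lebesgue_measure R]_(t in `]0, +oo[) (t `^ (s - 1) * expR (- t)).

(* J_nu(x) = (x/2)^nu sum_k (-1)^k (x/2)^(2k) / (k! Gamma(nu + k + 1)),
   meant for x > 0 and nu >= 0 *)
Definition besselJ nu x : R :=
  (x / 2) `^ nu *
  limn (series (fun k => (-1) ^+ k / (k`!%:R * Gamma (nu + k%:R + 1))
                         * (x / 2) ^+ (2 * k))).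

(* The least element of A; 0 if there is none. *)
Definition first (A : set R) : R := xget 0 (A `&` lbound A).

Definition bessel_zero nu : R := first [set x | 0 < x /\ besselJ nu x = 0].

(* The number c_nu(m), which also depends on lambda. *)
Definition bessel_c nu m lambda : R :=
  first [set c | 0 < 2 / m * c < bessel_zero nu /\
    (1 - 2 * lambda) * besselJ nu (2 / m * c) +
    2 * c * derive1 (besselJ nu) (2 / m * c) = 0].

End bessel.

(* Main.v *)
Require Import Defs.
From mathcomp Require Import all_boot all_order all_algebra.
From mathcomp Require Import all_classical all_reals all_analysis.
From mathcomp Require Import measurable_realfun.
From mathcomp Require Import ring lra.
Import Order.TTheory GRing.Theory Num.Theory.
Import numFieldNormedType.Exports.
Local Open Scope classical_set_scope.
Local Open Scope ring_scope.
Set Implicit Arguments.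
Unset Strict Implicit.
Unset Printing Implicit Defensive.

(** The inequality follows from a one-dimensional supersolution, transplanted to
    the domain by means of the distance to its boundary, and from Young's
    inequality.

    The supersolution. The function
    [y s = sqrt s * J_nu (2 / m * c * (s / d) `^ (m / 2))] satisfies
    [y'' = - ((1 - nu ^+ 2 * m ^+ 2) / (4 * s ^+ 2) + c ^+ 2 / d `^ m * s `^ (m - 2)) * y].
    The quantity [s * y' s / y s] decreases on [0 < s <= d] and, by the Robin
    condition that defines [c], ends at [lambda]; so [4 * (y' / y) ^+ 2] is at
    least [4 * lambda ^+ 2 / s ^+ 2]. Hence
    [V = 4 * y' / y - 4 * lambda ^+ 2 / s - 4 * (lambda - lambda ^+ 2) * s `^ (m - 1) / d `^ m]
    satisfies [- V' >= B] for the weight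
    [B s = (1 - nu ^+ 2 * m ^+ 2) / s ^+ 2
       + 4 * (c ^+ 2 + (m - 1) * (lambda - lambda ^+ 2)) / d `^ m / s `^ (2 - m)],
    while [0 <= V <= C / s] with [C = 2 * (1 + nu * m) - 4 * lambda ^+ 2]. This is
    [hardy_weight]. The Bessel function enters through its power series and its
    differential equation, which rest on the functional equation of Gamma.

    The domain. On a convex domain [delta] is concave, so in a weak sense
    [- div (V (delta) grad delta) >= - V' (delta) >= B (delta)], because
    [V >= 0] and the gradient of [delta] has norm 1. Testing this against
    [h = |g|^p] gives the L^1 inequality
    [\int h * B (delta) <= \int |grad h| * V (delta)], which is
    [weighted_L1_ineq]. As [delta] need not be differentiable, derivatives are
    replaced by second differences of [W (delta)], where [W' = V]: at each point
    [delta] is touched from above by an affine function whose slope is a unit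
    vector [e] ([delta_touch]), which bounds the sum over the axes of the second
    differences of step [t] by [- t ^+ 2 * B (delta)], up to a small error. The
    translation invariance of the Lebesgue measure moves one difference onto [h]
    ([I_second_difference]).

    Young's inequality. Since [|grad h| = p * |g|^(p - 1) * |grad g|], the choice
    of [a = |g|] and [b = p * C * delta * |grad g|] in
    [p * a `^ (p - 1) * (b - a) <= b `^ p - a `^ p] turns the L^1 inequality into
    the one with exponent [p]; part (ii) divides the L^1 inequality by
    [1 - nu ^+ 2 * m ^+ 2] beforehand. The L^1 inequality is proved with an
    arbitrary [d] above the inradius, so that [delta] stays away from the end of
    the interval, and [d] then decreases to the inradius. *)

(** * Powers with real exponents *)

Lemma continuous_powR_pos (R : realType) (a x : R) :
  0 < x -> {for x, continuous (fun y => y `^ a)}.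
Proof.
move=> x0; apply/differentiable_continuous/derivable1_diffP.
by apply: derivable_powR; rewrite in_itv/= x0.
Qed.

Lemma continuous_powR_norm (R : realType) (a : R) :
  0 <= a -> continuous (fun y : R => `|y| `^ a).
Proof.
rewrite le_eqVlt => /predU1P[<-|a0] x.
  rewrite (_ : (fun y => _) = cst 1); first exact: cvg_cst.
  by apply/funext => y; rewrite powRr0.
have [->|x0] := eqVneq x 0.
  rewrite /continuous_at normr0 powR0 ?gt_eqF//.
  apply/cvgrPdist_lt => e e0; near=> y.
  rewrite sub0r normrN ger0_norm ?powR_ge0//.
  have -> : e = (e `^ a^-1) `^ a by rewrite -powRrM mulVf ?gt_eqF// powRr1// ltW.
  rewrite gt0_ltr_powR ?nnegrE ?powR_ge0//.
  near: y; apply/nbhs_ballP; exists (e `^ a^-1) => /=; first exact: powR_gt0.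
  by move=> y; rewrite /ball/= sub0r normrN.
apply: (@continuous_comp _ _ _ (fun y : R => `|y|) (fun y : R => y `^ a)).
  exact: norm_continuous.
by apply: continuous_powR_pos; rewrite normr_gt0.
Unshelve. all: by end_near. Qed.

(** The tangent to a convex function lies below its graph; for [1 < p] this is
    Young's inequality for the conjugate exponents [p] and [p / (p - 1)]. *)
Lemma powR_tangent (R : realType) (p a b : R) :
  1 <= p -> 0 <= a -> 0 <= b ->
  p * a `^ (p - 1) * (b - a) <= b `^ p - a `^ p.
Proof.
rewrite le_eqVlt => /predU1P[<-|p1] a0 b0.
  by rewrite subrr powRr0 !powRr1// !mul1r.
have p0 : 0 < p by lra.
have q0 : 0 < p / (p - 1) by apply: divr_gt0 => //; lra.
have pN : p != 0 by rewrite gt_eqF.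
have pN1 : p - 1 != 0 by rewrite gt_eqF//; lra.
have /= := @conjugate_powR R b (a `^ (p - 1)) p (p / (p - 1)) b0 (powR_ge0 _ _) p0 q0.
have -> : p^-1 + (p / (p - 1))^-1 = 1 by field; rewrite pN1 pN.
rewrite -powRrM (_ : (p - 1) * (p / (p - 1)) = p); last by field.
move=> /(_ erefl); have := mulr_powRB1 a0 p0.
set u := a `^ (p - 1); set A := a `^ p; set B := b `^ p => <-.
rewrite -(ler_pM2l p0) => H.
have E : p * (B / p + a * u / (p / (p - 1))) = B + (p - 1) * (a * u).
  by field; rewrite pN1 pN.
by move: H; rewrite E; lra.
Qed.

(** * Euler's integral *)

Section gamma.
Variable R : realType.
Implicit Types a s t : R.

Let mu := @lebesgue_measure R.

Let h a t : R := t `^ a * expR (- t).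

Let K a : R := (2 * (a + 1)) `^ a.

(* exp(t / k) >= t / k with k = 2 (a + 1), raised to the power a *)
Let h_le a t : 0 <= a -> 0 <= t -> h a t <= K a * expR (- (t / 2)).
Proof.
move=> a0 t0; rewrite /h.
have -> : - t = - (t / 2) - t / 2 by field.
rewrite expRD mulrA ler_wpM2r ?expR_ge0//.
rewrite expRN -[leRHS]mulr1 ler_pdivrMr ?expR_gt0// mulr1.
set k := 2 * (a + 1); have k0 : 0 < k by rewrite /k; lra.
have tk : t <= k * expR (t / k).
  rewrite -ler_pdivrMl// mulrC; apply: le_trans (expR_ge1Dx _); lra.
apply: (@le_trans _ _ ((k * expR (t / k)) `^ a)).
  have /ge0_ler_powR := a0; apply; rewrite ?nnegrE//.
  by rewrite mulr_ge0 ?expR_ge0// ltW.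
rewrite powRM ?expR_ge0//; last exact: ltW.
rewrite -/(K a) ler_wpM2l ?powR_ge0// -expRM ler_expR.
rewrite mulrAC -mulrA; apply: ler_wpM2l => //.
by rewrite ler_pdivrMr// /k; lra.
Qed.

Let powR_at_right0 a : 0 <= a -> t `^ a @[t --> 0^'+] --> 0 `^ a.
Proof.
rewrite le_eqVlt => /predU1P[<-|a0].
  rewrite powRr0 (_ : (fun y => _) = cst 1); first exact: cvg_cst.
  by apply/funext => y; rewrite powRr0.
by rewrite powR0 ?gt_eqF//; exact: powR_cvg0.
Qed.

Let expRN_continuous : continuous (fun t : R => expR (- t)).
Proof.
move=> t; apply: continuous_comp; first exact: continuousN.
exact: continuous_expR.
Qed.

Let h_within a : 0 <= a -> {within `[0, +oo[, continuous (h a)}.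
Proof.
move=> a0; apply/continuous_within_itvcyP; split.
  move=> t; rewrite in_itv/= andbT => t0.
  by apply: cvgM; [exact: continuous_powR_pos|exact: expRN_continuous].
apply: cvgM; first exact: powR_at_right0.
by apply: cvg_at_right_filter; exact: expRN_continuous.
Qed.

Let expR_half (C : R) t :
  is_derive t 1 (fun t => C * (- 2 * expR (- (t / 2)))) (C * expR (- (t / 2))).
Proof.
apply: is_derive_eq.
by rewrite /GRing.scale/=; field.
Qed.

Let expR_half_cvg : expR (- (t / 2)) @[t --> +oo] --> (0 : R).
Proof.
apply: (@cvg_comp _ _ _ (fun t : R => t / 2) (fun t => expR (- t))).
  2: exact: cvgr_expR.
by apply: gt0_cvgMly.
Qed.

Let expR_half_continuous : continuous (fun t : R => expR (- (t / 2))).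
Proof.
move=> t; apply: (@continuous_comp _ _ _ (fun t : R => t / 2) (fun t => expR (- t))).
  exact: mulrr_continuous.
exact: expRN_continuous.
Qed.

Let h_measurable a : 0 <= a -> measurable_fun (`]0, +oo[%classic : set (measurableTypeR R)) (EFin \o h a).
Proof.
move=> a0; apply/measurable_EFinP; apply: open_continuous_measurable_fun => //.
by move: (h_within a0) => /continuous_within_itvcyP[/in_continuous_mksetP].
Qed.

Let expR_half_integral (C : R) : 0 <= C ->
  (\int[mu]_(t in `[0%R, +oo[) (C * expR (- (t / 2)))%:E = (2 * C)%:E)%E.
Proof.
move=> C0; rewrite (@ge0_continuous_FTC2y _ _ (fun t => C * (- 2 * expR (- (t / 2)))) 0 0).
- by rewrite -EFinB mul0r oppr0 expR0; congr EFin; ring.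
- by move=> t _; rewrite mulr_ge0 ?expR_ge0.
- apply: continuous_subspaceT => t.
  by apply: cvgM; [exact: cvg_cst|exact: expR_half_continuous].
- rewrite [X in _ --> X](_ : 0 = C * (- 2 * 0)); last by rewrite !mulr0.
  by apply: cvgM; [exact: cvg_cst|apply: cvgM; [exact: cvg_cst|]].
- by move=> t _; have [] := expR_half C t.
- apply: cvg_at_right_filter; apply: cvgM; first exact: cvg_cst.
  by apply: cvgM; [exact: cvg_cst|exact: expR_half_continuous].
- move=> t _; rewrite derive1E; have ? := expR_half C t.
  exact: derive_val.
Qed.

Let expR_half_integrable (C : R) : 0 <= C ->
  mu.-integrable `]0, +oo[ (fun t => (C * expR (- (t / 2)))%:E).
Proof.
move=> C0; apply/integrableP; split.
  apply/measurable_EFinP; apply: measurable_funM => //.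
  apply: measurable_funTS; apply: continuous_measurable_fun.
  exact: expR_half_continuous.
under eq_integral => t _ do rewrite gee0_abs ?lee_fin ?mulr_ge0 ?expR_ge0//.
rewrite integral_itv_obnd_cbnd ?expR_half_integral ?ltry//.
apply/measurable_EFinP; apply: measurable_funM => //.
apply: measurable_funTS; apply: continuous_measurable_fun.
exact: expR_half_continuous.
Qed.

Let h_integrable a : 0 <= a -> mu.-integrable `]0, +oo[ (EFin \o h a).
Proof.
move=> a0; apply: le_integrable (expR_half_integrable (powR_ge0 _ _ : 0 <= K a)) => //.
  exact: h_measurable.
move=> t/=; rewrite in_itv/= andbT => /ltW t0.
rewrite lee_fin !ger0_norm ?h_le//.
  by rewrite mulr_ge0 ?expR_ge0 ?powR_ge0.
by rewrite /h mulr_ge0 ?expR_ge0 ?powR_ge0.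
Qed.

Lemma GammaE s : Gamma s = \int[mu]_(t in `]0, +oo[) h (s - 1) t.
Proof. by []. Qed.

(** Integration by parts, carried out on a nonnegative function: adding
    [C * expR (- (t / 2))] to the derivative of [- t `^ s * expR (- t)] makes
    it nonnegative, so that monotone convergence applies. *)
Lemma GammaS s : 1 <= s -> Gamma (s + 1) = s * Gamma s.
Proof.
move=> s1; have s0 : 0 <= s by lra.
have s10 : 0 <= s - 1 by lra.
pose C := s * K (s - 1).
have C0 : 0 <= C by rewrite mulr_ge0 ?powR_ge0.
pose f t := h s t - s * h (s - 1) t + C * expR (- (t / 2)).
pose F t := - h s t + C * (- 2 * expR (- (t / 2))).
have If : (\int[mu]_(t in `[0%R, +oo[) (f t)%:E = (2 * C)%:E)%E.
  rewrite (@ge0_continuous_FTC2y _ f F 0 0).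
  - rewrite /F /h (_ : - (0 / 2) = 0) ?expR0; last by field.
    by rewrite powR0 ?gt_eqF ?(lt_le_trans _ s1)// -EFinB; congr EFin; ring.
  - move=> t t0; rewrite /f -addrA addr_ge0 ?mulr_ge0 ?powR_ge0 ?expR_ge0//.
    rewrite addrC subr_ge0 /C -mulrA ler_wpM2l//; exact: h_le.
  - move=> t; apply: cvgD; last first.
      by apply: cvgM; [exact: cvg_cst|exact: (continuous_subspaceT expR_half_continuous)].
    apply: cvgB; first exact: h_within.
    by apply: cvgM; [exact: cvg_cst|exact: h_within].
  - rewrite [X in _ --> X](_ : 0 = - 0 + C * (- 2 * 0)); last by ring.
    apply: cvgD; last first.
      by apply: cvgM; [exact: cvg_cst|apply: cvgM; [exact: cvg_cst|]].
    apply: cvgN; apply: (@squeeze_cvgr _ _ _ _ (cst 0) (fun t => K s * expR (- (t / 2)))).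
    + near=> t; have t0 : 0 <= t by near: t; exact: nbhs_pinfty_ge.
      by rewrite h_le// /h mulr_ge0 ?powR_ge0 ?expR_ge0.
    + exact: cvg_cst.
    + rewrite [X in _ --> X](_ : 0 = K s * 0); last by ring.
      by apply: cvgM => //; exact: cvg_cst.
  - move=> t t0; apply: derivableD; last first.
      by have [] := expR_half C t.
    apply: derivableN; apply: derivableM.
      by apply: derivable_powR; rewrite in_itv/= t0.
    by apply: ex_derive.
  - have /continuous_within_itvcyP[_ hr] := h_within s0.
    apply: cvgD; first exact: cvgN.
    apply: cvg_at_right_filter; apply: cvgM; first exact: cvg_cst.
    by apply: cvgM; [exact: cvg_cst|exact: expR_half_continuous].
  - move=> t; rewrite in_itv/= andbT => t0.
    have D1 := is_derive1_powR s t0.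
    have D2 := expR_half C t.
    suff : is_derive t 1 F (f t) by move=> ?; rewrite derive1E; exact: derive_val.
    rewrite /F /f /h; apply: is_derive_eq.
    by rewrite /GRing.scale/=; field.
have mf a : 0 <= a -> measurable_fun (`]0, +oo[%classic : set (measurableTypeR R)) (h a).
  by move=> /h_measurable /measurable_EFinP.
have me : measurable_fun (`]0, +oo[%classic : set (measurableTypeR R)) (fun t : R => C * expR (- (t / 2))).
  by have /measurable_int/measurable_EFinP := expR_half_integrable C0.
have i1 := h_integrable s0; have i2 := h_integrable s10.
have i3 := expR_half_integrable C0.
have : \int[mu]_(t in `]0, +oo[) f t = 2 * C.
  rewrite /Rintegral integral_itv_obnd_cbnd; first exact: (congr1 fine If).
  apply/measurable_EFinP; apply: measurable_funD => //.
  by apply: measurable_funB; [exact: mf|apply: measurable_funM => //; exact: mf].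
have i4 : mu.-integrable `]0, +oo[ (EFin \o (fun t => s * h (s - 1) t)).
  by apply: eq_integrable (integrableZl _ s i2) => // t _; rewrite /= EFinM.
rewrite /f RintegralD//; last first.
  by apply: eq_integrable (integrableB _ i1 i4) => // t _; rewrite /= EFinB.
rewrite RintegralB// RintegralZl//.
have -> : \int[mu]_(t in `]0, +oo[) (C * expR (- (t / 2))) = 2 * C.
  rewrite /Rintegral integral_itv_obnd_cbnd; last exact/measurable_EFinP.
  exact: (congr1 fine (expR_half_integral C0)).
rewrite 2!GammaE addrK.
set A := Rintegral _ _ _; set B := Rintegral _ _ _; lra.
Unshelve. all: by end_near. Qed.

Lemma Gamma_gt0 s : 1 <= s -> 0 < Gamma s.
Proof.
move=> s1; have s10 : 0 <= s - 1 by lra.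
rewrite GammaE /Rintegral fine_gt0//; apply/andP; split; last first.
  suff : (\int[mu]_(t in `]0%R, +oo[) (h (s - 1) t)%:E)%E \is a fin_num.
    by rewrite fin_numElt => /andP[].
  by apply: integrable_fin_num => //; exact: h_integrable.
apply: (@lt_le_trans _ _ (\int[mu]_(t in `[1%R, 2%R]) (expR (- 2)%R)%:E)%E).
  rewrite integral_cst//= lebesgue_measure_itv/= lte_fin ltr1n.
  by rewrite -EFinB -EFinM lte_fin mulr_gt0 ?expR_gt0//; lra.
apply: (@le_trans _ _ (\int[mu]_(t in `[1%R, 2%R]) (h (s - 1) t)%:E)%E).
  apply: ge0_le_integral => //.
  - apply: measurable_funS (h_measurable s10) => // t/=.
    by rewrite !in_itv/= => /andP[t1 _]; rewrite andbT; lra.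
  - move=> t /=; rewrite in_itv/= => /andP[t1 t2]; rewrite lee_fin /h.
    rewrite -[leLHS]mul1r ler_pM ?expR_ge0//.
      by rewrite -[leLHS](powRr0 t) ler_powR.
    by rewrite ler_expR; lra.
apply: ge0_subset_integral => //.
- exact: h_measurable.
- by move=> t _; rewrite lee_fin /h mulr_ge0 ?powR_ge0 ?expR_ge0.
- by move=> t/=; rewrite !in_itv/= => /andP[t1 _]; rewrite andbT; lra.
Qed.

End gamma.

(** * The Bessel function and its differential equation *)

(** Power series dominated by the exponential series; this class is stable under
    termwise differentiation. *)
Definition exp_dominated (R : realType) (c : R^nat) : Prop :=
  exists C : R, forall k, `|c k| <= C / k`!%:R.

Section exp_dominated.
Variables (R : realType) (c : R^nat).
Hypothesis domc : exp_dominated c.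

Lemma exp_dominated_diffs : exp_dominated (pseries_diffs c).
Proof.
have [C cC] := domc; exists C => k; rewrite /pseries_diffs normrM normr_nat.
apply: le_trans (ler_wpM2l (ler0n _ _) (cC k.+1)) _.
rewrite factS natrM invfM mulrCA [X in _ * X <= _]mulrA mulfV ?mul1r//.
Qed.

Lemma exp_dominated_cvg x : cvgn (pseries c x).
Proof.
have [C cC] := domc; apply: normed_cvg.
have : cvgn (series (C *: exp_coeff `|x|)).
  by apply: is_cvg_seriesZ; exact: is_cvg_series_exp_coeff.
apply: series_le_cvg => k /=.
- exact: normr_ge0.
- rewrite /GRing.scale/= /exp_coeff mulr_ge0 ?exp_coeff_ge0//.
  by have := le_trans (normr_ge0 _) (cC 0); rewrite fact0 divr1.
- rewrite -[leRHS]/(C * (`|x| ^+ k / k`!%:R)) normrM normrX.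
  apply: le_trans (ler_wpM2r (exprn_ge0 _ (normr_ge0 x)) (cC k)) _.
  by rewrite mulrAC -mulrA.
Qed.

End exp_dominated.

Lemma exp_dominated_derive (R : realType) (c : R^nat) (x : R) :
  exp_dominated c ->
  is_derive x (1 : R) (fun x => limn (pseries c x))
    (limn (pseries (pseries_diffs c) x)).
Proof.
move=> dc; apply: (@pseries_snd_diffs _ _ (`|x| + 1)).
- exact: exp_dominated_cvg.
- by apply: exp_dominated_cvg; exact: exp_dominated_diffs.
- by apply: exp_dominated_cvg; do 2 apply: exp_dominated_diffs.
- by rewrite [ltRHS]ger0_norm ?ltrDl// addr_ge0.
Qed.

Section bessel_series.
Variables (R : realType) (nu : R).
Hypothesis nu0 : 0 <= nu.

Let a (k : nat) : R := (-1) ^+ k / (k`!%:R * Gamma (nu + k%:R + 1)).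

(** [besselJ nu z] is [(z / 2) `^ nu] times this function at [(z / 2) ^+ 2]. *)
Definition bessel_series (t : R) : R := limn (pseries a t).
Definition bessel_series1 (t : R) : R := limn (pseries (pseries_diffs a) t).
Definition bessel_series2 (t : R) : R :=
  limn (pseries (pseries_diffs (pseries_diffs a)) t).

Let Gamma_pos k : 0 < Gamma (nu + k%:R + 1).
Proof. by apply: Gamma_gt0; rewrite lerDr addr_ge0. Qed.

Let Gamma_ge k : Gamma (nu + 1) <= Gamma (nu + k%:R + 1).
Proof.
elim: k => [|k IH]; first by rewrite addr0.
have -> : nu + k.+1%:R + 1 = (nu + k%:R + 1) + 1 by rewrite -natr1; ring.
have k1 : 1 <= nu + k%:R + 1 by rewrite lerDr addr_ge0.
by rewrite (GammaS k1) (le_trans IH)// ler_peMl// ltW.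
Qed.

Let doma : exp_dominated a.
Proof.
have G0 := Gamma_pos 0; rewrite addr0 in G0.
exists (Gamma (nu + 1))^-1 => k; rewrite /a normrM normrX normrN1 expr1n mul1r.
rewrite ger0_norm; last by rewrite invr_ge0 mulr_ge0// ltW.
rewrite mulrC -invfM lef_pV2 ?posrE ?mulr_gt0 ?ltr0n ?fact_gt0//.
by rewrite ler_wpM2r.
Qed.

(* The functional equation of Gamma, in the form that makes the series solve its
   differential equation termwise. *)
Let coefS k : (nu + k.+1%:R) * pseries_diffs a k = - a k.
Proof.
rewrite /pseries_diffs /a.
have -> : nu + k.+1%:R + 1 = (nu + k%:R + 1) + 1 by rewrite -natr1; ring.
have k1 : 1 <= nu + k%:R + 1 by rewrite lerDr addr_ge0.
rewrite GammaS// factS natrM exprS -natr1.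
have := Gamma_pos k; set g := Gamma _ => g0.
have f0 : k`!%:R != 0 :> R by rewrite pnatr_eq0 -lt0n fact_gt0.
have k0 : 0 <= k%:R :> R by [].
by field; rewrite !gt_eqF//; lra.
Qed.

Lemma is_derive_bessel_series t :
  is_derive t (1 : R) bessel_series (bessel_series1 t).
Proof. exact: exp_dominated_derive. Qed.

Lemma is_derive_bessel_series1 t :
  is_derive t (1 : R) bessel_series1 (bessel_series2 t).
Proof. by apply: exp_dominated_derive; exact: exp_dominated_diffs. Qed.

(** Bessel's equation for [besselJ nu], in the variable [t = (z / 2) ^+ 2] and
    freed of the factor [(z / 2) `^ nu]. *)
Lemma bessel_series_ode t :
  t * bessel_series2 t + (nu + 1) * bessel_series1 t + bessel_series t = 0.
Proof.
have d1 := exp_dominated_diffs doma; have d2 := exp_dominated_diffs d1.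
have c0 : pseries a t @ \oo --> bessel_series t.
  exact: exp_dominated_cvg.
have c1 : pseries (pseries_diffs a) t @ \oo --> bessel_series1 t.
  exact: exp_dominated_cvg.
have c2 := pseries_diffs_equiv (exp_dominated_cvg d2 (x := t)).
have c3 : (fun n => t * series (fun i => i%:R * pseries_diffs a i * t ^+ i.-1) n
    + (nu + 1) * pseries (pseries_diffs a) t n + pseries a t n) @ \oo -->
    t * bessel_series2 t + (nu + 1) * bessel_series1 t + bessel_series t.
  by apply: cvgD => //; apply: cvgD; apply: cvgM => //; exact: cvg_cst.
rewrite -(cvg_lim (@Rhausdorff R) c3).
rewrite [X in lim (X @ _)](_ : _ = cst 0); first exact: lim_cst.
apply/funext => n; rewrite /pseries /series/=.
rewrite !mulr_sumr -!big_split/= big1// => -[|i] _.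
  rewrite !mul0r mulr0 add0r !expr0 !mulr1.
  by have := coefS 0; rewrite mulrC => E; rewrite -[a 0]opprK -E; ring.
have := coefS i.+1; set b := pseries_diffs a i.+1 => E.
rewrite -[a i.+1]opprK -E -[in RHS](mul0r (t ^+ i.+1)) -natr1 exprS; ring.
Qed.

Lemma bessel_series0 : 0 < bessel_series 0.
Proof.
suff -> : bessel_series 0 = a 0.
  by rewrite /a expr0 mul1r fact0 mul1r invr_gt0.
apply/cvg_lim => //; rewrite -cvg_shiftS.
rewrite [X in X @ _ --> _](_ : _ = cst (a 0)); first exact: cvg_cst.
apply/funext => n; rewrite /pseries /series/= big_nat_recl// expr0 mulr1.
by rewrite big1 ?addr0// => i _; rewrite expr0n mulr0.
Qed.

Lemma besselJE z : besselJ nu z = (z / 2) `^ nu * bessel_series ((z / 2) ^+ 2).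
Proof.
rewrite /besselJ /bessel_series /pseries.
have -> // : (fun k => (-1) ^+ k / (k`!%:R * Gamma (nu + k%:R + 1)) * (z / 2) ^+ (2 * k))
    = (fun k => a k * ((z / 2) ^+ 2) ^+ k).
by apply/funext => k; rewrite exprM.
Qed.

Lemma derive1_besselJ z : 0 < z ->
  derive1 (besselJ nu) z = nu / z * besselJ nu z
    + (z / 2) `^ nu * (z / 2) * bessel_series1 ((z / 2) ^+ 2).
Proof.
move=> z0; have z20 : 0 < z / 2 by rewrite divr_gt0.
have -> : besselJ nu = fun y => (y / 2) `^ nu * bessel_series ((y / 2) ^+ 2).
  by apply/funext => y; exact: besselJE.
have D0 : is_derive z 1 (fun y : R => y / 2) 2^-1.
  by apply: is_derive_eq; rewrite /GRing.scale/=; field.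
have D1 : is_derive z 1 (fun y : R => (y / 2) `^ nu)
    (nu * (z / 2) `^ (nu - 1) * 2^-1).
  have := is_derive1_powR nu z20 => D.
  have := @is_derive1_comp R (fun y : R => y `^ nu) (fun y : R => y / 2) z _ _ D D0.
  by rewrite /GRing.scale/= mulrC.
have D2 : is_derive z 1 (fun y : R => (y / 2) ^+ 2) (z / 2).
  by apply: is_derive_eq; rewrite /GRing.scale/=; field.
have D3 : is_derive z 1 (fun y : R => bessel_series ((y / 2) ^+ 2))
    (bessel_series1 ((z / 2) ^+ 2) * (z / 2)).
  have D := is_derive_bessel_series ((z / 2) ^+ 2).
  have := @is_derive1_comp R bessel_series (fun y : R => (y / 2) ^+ 2) z _ _ D D2.
  by rewrite /GRing.scale/= mulrC.
rewrite derive1E; apply: derive_val.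
apply: is_derive_eq; rewrite /GRing.scale/=.
have -> : (z / 2) `^ (nu - 1) = (z / 2) `^ nu / (z / 2).
  by rewrite powRB ?(gt_eqF z20) ?implybT// powRr1// ltW.
field.
by rewrite gt_eqF.
Qed.

End bessel_series.

(** * The one-dimensional weight *)

Lemma is_derive_continuous_at (R : realType) (f : R -> R) (s df : R) :
  is_derive s (1 : R) f df -> {for s, continuous f}.
Proof. by move=> [D _]; apply/differentiable_continuous/derivable1_diffP. Qed.

(** [t `^ k * G t] is nondecreasing, because its derivative is
    [t `^ (k - 1) * (t * G' t + k * G t)]; it is positive near 0. *)
Lemma euler_ineq_gt0 (R : realType) (G G' : R -> R) (k T : R) :
  0 < k -> 0 < G 0 ->
  (forall t : R, is_derive t (1 : R) G (G' t)) ->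
  (forall t : R, 0 <= t <= T -> 0 <= t * G' t + k * G t) ->
  forall t : R, 0 <= t <= T -> 0 < G t.
Proof.
move=> k0 G0 DG euler t /andP[]; rewrite le_eqVlt => /predU1P[<- //|t0 tT].
have [e [e0 et Ge]] : exists e, [/\ 0 < e, e < t & 0 < G e].
  have /cvgr_gt/(_ _ G0)/nbhs_ballP[r /= r0 rG] := is_derive_continuous_at (DG 0).
  exists (Num.min (r / 2) (t / 2)); split.
  - by rewrite lt_min !divr_gt0.
  - by rewrite gt_min; apply/orP; right; lra.
  - apply: rG; rewrite /ball/= sub0r normrN ger0_norm.
      by rewrite gt_min; apply/orP; left; lra.
    by rewrite le_min !divr_ge0// ltW.
pose E s := s `^ k * G s.
have DE (s : R) : 0 < s -> is_derive s 1 E (s `^ (k - 1) * (s * G' s + k * G s)).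
  move=> s0; have D1 := is_derive1_powR k s0; apply: is_derive_eq.
  rewrite -(mulr_powRB1 (ltW s0) k0) /GRing.scale/=; ring.
have [||c] := @MVT R E (fun s => s `^ (k - 1) * (s * G' s + k * G s)) e t et.
- by move=> s; rewrite in_itv/= => /andP[es _]; apply: DE; exact: lt_trans es.
- apply: derivable_within_continuous => s; rewrite in_itv/= => /andP[es _].
  by have [] := DE s (lt_le_trans e0 es).
rewrite in_itv/= => /andP[ec ct] EE.
have : 0 < E t.
  have -> : E t = E e + (E t - E e) by ring.
  rewrite EE ltr_pwDl ?mulr_gt0 ?powR_gt0// !mulr_ge0 ?powR_ge0//; last by lra.
  by apply: euler; lra.
by rewrite pmulr_rgt0// powR_gt0.
Qed.

Section log_derivative.
Variables (R : realType) (nu T : R) (F F1 F2 : R -> R).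
Hypothesis nu0 : 0 <= nu.
Hypothesis DF : forall t : R, is_derive t (1 : R) F (F1 t).
Hypothesis DF1 : forall t : R, is_derive t (1 : R) F1 (F2 t).
Hypothesis ode : forall t : R, t * F2 t + (nu + 1) * F1 t + F t = 0.
Hypothesis F_gt0 : forall t : R, 0 <= t <= T -> 0 < F t.

(** With [J z = (z / 2) `^ nu * F ((z / 2) ^+ 2)], this is half of
    [nu - z * J' z / J z]. *)
Definition neg_log_derivative t : R := - (t * F1 t / F t).

Let energy t := F t ^+ 2 + nu * F t * F1 t + t * F1 t ^+ 2.

(* In terms of J, the product of 4 * t `^ (nu + 1) and the energy is
   z ^+ 2 * J' z ^+ 2 + (z ^+ 2 - nu ^+ 2) * J z ^+ 2, whose derivative in z is
   2 * z * J z ^+ 2, hence nonnegative. *)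
Let energy_gt0 (t : R) : 0 <= t <= T -> 0 < energy t.
Proof.
move=> tT; have T0 : 0 <= T by have /andP[] := tT; exact: le_trans.
apply: (@euler_ineq_gt0 _ energy (fun t => 2 * F t * F1 t +
  nu * (F1 t ^+ 2 + F t * F2 t) + F1 t ^+ 2 + 2 * t * F1 t * F2 t) (nu + 1) T) => //.
- by rewrite ltr_wpDl.
- have F00 : 0 < F 0 by apply: F_gt0; rewrite lexx.
  have F10 : F1 0 = - (F 0 / (nu + 1)).
    have := ode 0; rewrite mul0r add0r => /eqP; rewrite addr_eq0 => /eqP E.
    by rewrite -mulNr -E mulrAC mulfV ?mul1r// gt_eqF// ltr_wpDl.
  rewrite /energy F10.
  have -> : F 0 ^+ 2 + nu * F 0 * - (F 0 / (nu + 1)) + 0 * (- (F 0 / (nu + 1))) ^+ 2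
    = F 0 ^+ 2 / (nu + 1) by field; rewrite gt_eqF// ltr_wpDl.
  by rewrite divr_gt0 ?exprn_gt0// ltr_wpDl.
- move=> s; rewrite /energy; apply: is_derive_eq; rewrite /GRing.scale/=; ring.
- move=> s _; have -> : s * (2 * F s * F1 s + nu * (F1 s ^+ 2 + F s * F2 s) +
     F1 s ^+ 2 + 2 * s * F1 s * F2 s) + (nu + 1) * energy s =
     F s ^+ 2 + (nu * F s + 2 * s * F1 s) * (s * F2 s + (nu + 1) * F1 s + F s).
    by rewrite /energy; ring.
  by rewrite ode mulr0 addr0 sqr_ge0.
Qed.

Lemma is_derive_neg_log_derivative (t : R) : F t != 0 ->
  is_derive t (1 : R) neg_log_derivative
    ((F t ^+ 2 + nu * F t * F1 t + t * F1 t ^+ 2) / F t ^+ 2).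
Proof.
move=> Ft; have DV := is_deriveV Ft (DF t).
rewrite /neg_log_derivative; apply: is_derive_eq; rewrite /GRing.scale/=.
have -> : F t ^+ 2 + nu * F t * F1 t + t * F1 t ^+ 2 =
    - (t * F2 t + F1 t) * F t + t * F1 t ^+ 2
    + F t * (t * F2 t + (nu + 1) * F1 t + F t) by ring.
by rewrite ode; field.
Qed.

Lemma neg_log_derivative_le (s t : R) : 0 <= s -> s <= t -> t <= T ->
  neg_log_derivative s <= neg_log_derivative t.
Proof.
move=> s0; rewrite le_eqVlt => /predU1P[<- //|st] tT.
have FT (u : R) : s <= u -> u <= t -> 0 < F u by move=> ? ?; apply: F_gt0; lra.
have DQ (u : R) : s <= u -> u <= t -> is_derive u 1 neg_log_derivative
    ((F u ^+ 2 + nu * F u * F1 u + u * F1 u ^+ 2) / F u ^+ 2).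
  by move=> su ut; apply: is_derive_neg_log_derivative; rewrite gt_eqF// FT.
have [||c] := @MVT R neg_log_derivative
  (fun u => (F u ^+ 2 + nu * F u * F1 u + u * F1 u ^+ 2) / F u ^+ 2) s t st.
- by move=> u; rewrite in_itv/= => /andP[/ltW su /ltW ut]; exact: DQ.
- apply: derivable_within_continuous => u; rewrite in_itv/= => /andP[su ut].
  by have [] := DQ u su ut.
rewrite in_itv/= => /andP[/ltW sc /ltW ct] E.
rewrite -subr_ge0 E mulr_ge0//; last by lra.
by rewrite divr_ge0 ?sqr_ge0//; apply/ltW/energy_gt0; lra.
Qed.

End log_derivative.

Lemma firstP (R : realType) (A : set R) :
  first A = 0 \/ A (first A) /\ lbound A (first A).
Proof. by rewrite /first; case: xgetP => [x _ []|]; [right|left]. Qed.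

(** The Robin condition that defines [bessel_c nu m lambda], expressed through the
    power series: the last inequality is then an equality. When [bessel_c] takes
    its default value 0, it reduces to [lambda <= (1 + nu * m) / 2]; asking for an
    inequality alone covers both cases. *)
Lemma bessel_c_spec (R : realType) (nu m lambda : R) (t0 := (bessel_c nu m lambda / m) ^+ 2) :
  0 < m -> 0 <= nu -> lambda <= (1 + nu * m) / 2 ->
  (forall t : R, 0 <= t <= t0 -> 0 < bessel_series nu t) /\
  m * neg_log_derivative (bessel_series nu) (bessel_series1 nu) t0
    <= (1 + nu * m) / 2 - lambda.
Proof.
move=> m0 nu0 lam; rewrite /t0 /bessel_c.
set S := (X in first X); case: (firstP S) => [->|].
  rewrite mul0r expr0n/= /neg_log_derivative !mul0r oppr0 mulr0; split; last lra.
  move=> t; rewrite -eq_le => /eqP <-; exact: bessel_series0.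
set c := first S => -[[/andP[z0 zj] robin] _].
set z := 2 / m * c in z0 zj robin.
have mN : m != 0 by rewrite gt_eqF.
have c0 : 0 < c by move: z0; rewrite pmulr_rgt0// divr_gt0.
have z2 : z / 2 = c / m by rewrite /z; field.
have pos (t : R) : 0 <= t <= (c / m) ^+ 2 -> 0 < bessel_series nu t.
  move=> /andP[t0' tc]; rewrite ltNge; apply/negP => Ft.
  have F0 := bessel_series0 nu0.
  have [||s] := @IVT _ (bessel_series nu) 0 t 0 t0'.
  - apply: continuous_subspaceT => u.
    exact: is_derive_continuous_at (is_derive_bessel_series nu0 u).
  - by rewrite ge_min le_max Ft (ltW F0) orbT.
  rewrite in_itv/= => /andP[]; rewrite le_eqVlt => /predU1P[<-|s0 st] Fs.
    by move=> F00; rewrite F00 ltxx in F0.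
  have : 0 < 2 * Num.sqrt s /\ besselJ nu (2 * Num.sqrt s) = 0.
    split; first by rewrite mulr_gt0 ?sqrtr_gt0.
    by rewrite besselJE mulrAC divff// mul1r sqr_sqrtr ?(ltW s0)// Fs mulr0.
  move: zj; rewrite /bessel_zero; set Z := (X in first X).
  case: (firstP Z) => [-> /(lt_trans z0)|[_ lb] zj /lb]; first by rewrite ltxx.
  move=> /(lt_le_trans zj); apply/negP; rewrite -leNgt.
  have -> : z = 2 * (z / 2) by field.
  rewrite ler_pM2l// z2 -[leRHS](@gtr0_norm _ (c / m)) ?divr_gt0// -sqrtr_sqr.
  by rewrite ler_wsqrtr// (le_trans st).
split=> //.
have Ft : 0 < bessel_series nu ((c / m) ^+ 2) by apply: pos; rewrite sqr_ge0 lexx.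
have P : 0 < (c / m) `^ nu by apply: powR_gt0; exact: divr_gt0.
move: robin; rewrite (derive1_besselJ nu0 z0) besselJE z2.
rewrite /neg_log_derivative.
set f := bessel_series nu _ in Ft *; set f1 := bessel_series1 nu _.
have -> : nu / z = nu * m / (2 * c) by rewrite /z; field; rewrite mN gt_eqF.
set P' := (c / m) `^ nu in P *.
have -> : (1 - 2 * lambda) * (P' * f) +
  2 * c * (nu * m / (2 * c) * (P' * f) + P' * (c / m) * f1) =
  P' * ((1 - 2 * lambda + nu * m) * f + 2 * m * (c / m) ^+ 2 * f1).
  by field; rewrite mN gt_eqF.
move=> /eqP; rewrite mulf_eq0 gt_eqF//= => /eqP E.
have -> : m * - ((c / m) ^+ 2 * f1 / f) = - (2 * m * (c / m) ^+ 2 * f1) / f / 2.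
  by field; rewrite mN gt_eqF.
have -> : - (2 * m * (c / m) ^+ 2 * f1) = (1 - 2 * lambda + nu * m) * f.
  by apply/eqP; rewrite eqr_oppLR -subr_eq0 opprK addrC E.
by rewrite mulfK ?gt_eqF//; lra.
Qed.

(** With [y s = s `^ ((1 + nu * m) / 2) * F (t0 * (s / d) `^ m)], a constant
    multiple of [sqrt s * J_nu (2 / m * c * (s / d) `^ (m / 2))] if [c] is not 0,
    the linear equation for [y] gives
    [(4 * y' / y)' = - (A + 4 * c ^+ 2 * (s / d) `^ m + 4 * (s * y' / y) ^+ 2) / s ^+ 2].
    As [s * y' / y >= lambda] up to [s = d], the square pays for subtracting
    [4 * lambda ^+ 2 * ln s] from [4 * ln y], which lowers the constant [C]. The
    last term of [W] yields the summand [(m - 1) * (lambda - lambda ^+ 2)] and is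
    small enough to leave [V] nonnegative up to [d]. *)
Lemma hardy_weight (R : realType) (nu m lambda d : R) :
  1 < m -> 0 <= nu <= 1 / m -> 0 <= lambda < (1 + nu * m) / 2 -> 0 < d ->
  let A := 1 - nu ^+ 2 * m ^+ 2 in
  let b := 4 * (bessel_c nu m lambda ^+ 2 + (m - 1) * (lambda - lambda ^+ 2)) in
  let C := 2 * (1 + nu * m) - 4 * lambda ^+ 2 in
  exists W V : R -> R, forall s : R, 0 < s < d ->
    [/\ is_derive s (1 : R) W (V s), 0 <= V s <= C / s &
      exists2 dV, is_derive s (1 : R) V dV &
        dV <= - (A / s ^+ 2 + b / d `^ m / s `^ (2 - m))].
Proof.
move=> m1 /andP[nu0 num] /andP[lam0 lam] d0 A b C.
have m0 : 0 < m by lra.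
have mN : m != 0 by rewrite gt_eqF.
have nm1 : nu * m <= 1 by rewrite -ler_pdivlMr.
have lam1 : lambda < 1 by lra.
have l2 : 0 <= lambda - lambda ^+ 2.
  by rewrite (_ : _ - _ = lambda * (1 - lambda)); [apply: mulr_ge0; lra|ring].
have [Fpos Qle] := bessel_c_spec m0 nu0 (ltW lam).
set c := bessel_c nu m lambda in b Fpos Qle *.
set t0 := (c / m) ^+ 2 in Fpos Qle *; have t00 : 0 <= t0 by exact: sqr_ge0.
set F := bessel_series nu in Fpos Qle *.
set F1 := bessel_series1 nu in Qle *.
set F2 := bessel_series2 nu.
have DF := is_derive_bessel_series nu0 : forall t : R, is_derive t 1 F (F1 t).
have DF1 := is_derive_bessel_series1 nu0 : forall t : R, is_derive t 1 F1 (F2 t).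
have ode := bessel_series_ode nu0 : forall t : R, t * F2 t + (nu + 1) * F1 t + F t = 0.
pose Q := neg_log_derivative F F1.
pose tau s := (s / d) `^ m.
pose W s := C * ln s + 4 * ln (F (t0 * tau s)) - 4 * (lambda - lambda ^+ 2) / m * tau s.
pose V s := (C - 4 * m * Q (t0 * tau s) - 4 * (lambda - lambda ^+ 2) * tau s) / s.
exists W, V => s /andP[s0 sd].
have sN : s != 0 by rewrite gt_eqF.
have tau0 : 0 <= tau s by exact: powR_ge0.
have tau1 : tau s <= 1.
  have <- : 1 `^ m = 1 :> R by rewrite powR1.
  apply: ge0_ler_powR; rewrite ?nnegrE// ?divr_ge0 ?ltW//.
  by rewrite ltr_pdivrMr// mul1r.
have t1 : 0 <= t0 * tau s by exact: mulr_ge0.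
have t2 : t0 * tau s <= t0 by rewrite ler_piMr.
have Ft : 0 < F (t0 * tau s) by apply: Fpos; rewrite t1.
have Dtau : is_derive s 1 tau (m * tau s / s).
  have sd0 : 0 < s / d by rewrite divr_gt0.
  have D0 : is_derive s 1 (fun y : R => y / d) d^-1.
    by apply: is_derive_eq; rewrite /GRing.scale/=; ring.
  have := @is_derive1_comp R (fun y : R => y `^ m) _ s _ _ (is_derive1_powR m sd0) D0.
  rewrite /GRing.scale/= powRB ?(gt_eqF sd0) ?implybT// powRr1 ?ltW//.
  rewrite -/(tau s) (_ : m * (tau s / (s / d)) / d = m * tau s / s)//.
  by field; rewrite sN gt_eqF.
have Dt : is_derive s 1 (fun y => t0 * tau y) (t0 * (m * tau s / s)).
  by apply: is_derive_eq; rewrite /GRing.scale/=; ring.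
have FN : F (t0 * tau s) != 0 by rewrite gt_eqF.
have DQ := is_derive_neg_log_derivative DF DF1 ode FN.
have DQt := @is_derive1_comp R Q _ s _ _ DQ Dt.
have DFt := @is_derive1_comp R F _ s _ _ (DF (t0 * tau s)) Dt.
have DlnF := @is_derive1_comp R (@ln R) _ s _ _ (is_derive1_ln Ft) DFt.
have Dln := is_derive1_ln s0.
have Dinv : is_derive s 1 (fun y : R => y^-1) (- s ^- 2).
  have := is_deriveV sN (is_derive_id s (1 : R)).
  by rewrite /GRing.scale/= mulr1.
have Q0 : 0 <= Q (t0 * tau s).
  have := neg_log_derivative_le nu0 DF DF1 ode Fpos (lexx 0) t1 t2.
  by rewrite {1}/neg_log_derivative !mul0r oppr0.
have Qt : m * Q (t0 * tau s) <= (1 + nu * m) / 2 - lambda.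
  apply: le_trans Qle; rewrite ler_pM2l//.
  exact: (neg_log_derivative_le nu0 DF DF1 ode Fpos t1 t2 (lexx _)).
set q := Q (t0 * tau s) in Q0 Qt.
have qE : q = - (t0 * tau s * F1 (t0 * tau s) / F (t0 * tau s)) by [].
split.
- rewrite /W; apply: is_derive_eq; rewrite /GRing.scale/=.
  by rewrite /V -/q qE; field; rewrite mN sN FN.
- rewrite /V -/q; apply/andP; split.
    apply: divr_ge0; last exact: ltW.
    have : (lambda - lambda ^+ 2) * tau s <= lambda - lambda ^+ 2 by rewrite ler_piMr.
    by rewrite /C; lra.
  rewrite ler_pM2r ?invr_gt0//.
  have : 0 <= (lambda - lambda ^+ 2) * tau s by exact: mulr_ge0.
  have : 0 <= m * q by apply: mulr_ge0 => //; exact: ltW.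
  lra.
- have tQ : t0 * tau s * ((F (t0 * tau s) ^+ 2
      + nu * F (t0 * tau s) * F1 (t0 * tau s)
      + t0 * tau s * F1 (t0 * tau s) ^+ 2) / F (t0 * tau s) ^+ 2) =
      t0 * tau s - nu * q + q ^+ 2 by rewrite qE; field.
  exists ((- (4 * m ^+ 2 * (t0 * tau s - nu * q + q ^+ 2))
      - 4 * (lambda - lambda ^+ 2) * m * tau s
      - (C - 4 * m * q - 4 * (lambda - lambda ^+ 2) * tau s)) / s ^+ 2).
    rewrite /V; apply: is_derive_eq; rewrite /GRing.scale/= -tQ -/q.
    by field; rewrite sN FN.
  have -> : b / d `^ m / s `^ (2 - m) = b * tau s / s ^+ 2.
    rewrite powRB ?sN ?implybT// powR_mulrn ?ltW// /tau powRM ?invr_ge0 ?ltW//.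
    rewrite -[d^-1]powR_inv1 ?ltW// -powRrM mulN1r powRN.
    by field; rewrite sN !gt_eqF ?powR_gt0.
  have -> : A / s ^+ 2 + b * tau s / s ^+ 2 = (A + b * tau s) / s ^+ 2 by ring.
  rewrite -[leRHS]mulNr ler_pM2r ?invr_gt0 ?exprn_gt0//.
  have w2 : lambda ^+ 2 <= ((1 + nu * m) / 2 - m * q) ^+ 2.
    by rewrite ler_pXn2r ?nnegrE//; lra.
  have t0E : m ^+ 2 * t0 = c ^+ 2 by rewrite /t0; field.
  have -> : 4 * m ^+ 2 * (t0 * tau s - nu * q + q ^+ 2) =
      4 * (c ^+ 2 * tau s) + 4 * m ^+ 2 * (q ^+ 2 - nu * q) by rewrite -t0E; ring.
  by move: w2; rewrite /A /b /C; lra.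
Qed.
(** * Borel sets of R^n *)

Section rV_borel.
Variables (R : realType) (n : nat).

(* A pair codes a centre and a radius. *)
Let cube (q : 'rV[rat]_n * nat) : set 'rV[R]_n :=
  [set x | forall i, `|x ord0 i - ratr (q.1 ord0 i)| < q.2.+1%:R^-1].

Lemma measurable_coord_box (A : 'I_n -> set (measurableTypeR R)) :
  (forall i, measurable (A i)) ->
  measurable [set x : 'rV[R]_n | forall i, A i (x ord0 i)].
Proof.
move=> mA; rewrite (_ : [set x | _] = \bigcap_(i in [set: 'I_n])
    ((fun x : 'rV[R]_n => x ord0 i : measurableTypeR R) @^-1` A i)).
  apply: fin_bigcap_measurable => // i _.
  by rewrite -[X in measurable X]setTI; exact: measurable_rV_coord.
by apply/seteqP; split => x /= Ax i => [_|]; exact: Ax.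
Qed.

Let measurable_cube q : measurable (cube q).
Proof.
rewrite (_ : cube q = [set x | forall i,
    `](ratr (q.1 ord0 i) - q.2.+1%:R^-1), (ratr (q.1 ord0 i) + q.2.+1%:R^-1)[%classic
    (x ord0 i)]).
  apply: (@measurable_coord_box (fun i => `](ratr (q.1 ord0 i) - q.2.+1%:R^-1),
    (ratr (q.1 ord0 i) + q.2.+1%:R^-1)[%classic)) => i; exact: measurable_itv.
apply/seteqP; split => x /= H i; move: (H i).
  by rewrite in_itv/= ltr_distl.
by rewrite in_itv/= ltr_distl.
Qed.

(** An open set is the union of countably many cubes, those with rational centre
    that it contains. *)
Lemma open_measurable_rV (U : set 'rV[R]_n) : open U -> measurable U.
Proof.
move=> oU.
rewrite (_ : U = \bigcup_q (if pselect (cube q `<=` U) then cube q else set0)).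
  apply: countable_bigcupT_measurable => [|q]; first exact: countableP.
  by case: pselect => H; [exact: measurable_cube|exact: measurable0].
apply/seteqP; split => [x Ux|x [q _]]; last by case: pselect => /= [H|_ []]; exact: H.
have /nbhs_ballP[e /= e0 xe] := open_nbhs_nbhs (conj oU Ux).
pose k := Num.truncn (2 / e).
have k0 : 0 < k.+1%:R^-1 :> R by rewrite invr_gt0.
have ke : k.+1%:R^-1 + k.+1%:R^-1 <= e.
  have : 2 / e < k.+1%:R by apply: Num.Theory.truncnS_gt.
  rewrite ltr_pdivrMr// mulrC -ltr_pdivrMr// => /ltW.
  by rewrite (_ : 2 / _ = k.+1%:R^-1 + k.+1%:R^-1)//; ring.
set r : R := k.+1%:R^-1 in k0 ke.
have qP i : {q : rat | `|x ord0 i - ratr q| < r}.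
  apply: cid; have : x ord0 i - r < x ord0 i + r by lra.
  move=> /rat_in_itvoo[q]; rewrite in_itv/= => /andP[q1 q2].
  by exists q; rewrite ltr_norml; apply/andP; split; lra.
exists (\row_i sval (qP i), k) => //; case: pselect => [_ i|] /=.
  by rewrite mxE; exact: (svalP (qP i)).
case=> y yq; apply: xe; split => // i j; rewrite (ord1 i).
have := yq j; have := svalP (qP j); rewrite /= mxE; set q := sval _.
rewrite /ball/= => h1 h2.
rewrite (_ : x ord0 j - y ord0 j = (x ord0 j - ratr q) - (y ord0 j - ratr q)); last by ring.
by rewrite (le_lt_trans (ler_normB _ _))// (lt_le_trans (ltrD h1 h2)).
Qed.

Lemma continuous_measurable_rV (f : 'rV[R]_n -> R) :
  continuous f -> measurable_fun setT (f : 'rV[R]_n -> measurableTypeR R).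
Proof.
move=> /continuousP cf; apply: (measurability _ (RGenOInfty.measurableE R)).
move=> _ [_ [a ->]] <-; rewrite setTI set_itvE; apply: open_measurable_rV.
exact/cf/open_gt.
Qed.

End rV_borel.

(** * Lebesgue measure on R^n is invariant under translation *)

Lemma lebesgue_measure_translation (R : realType) (a : R)
    (f : measurableTypeR R -> \bar R) :
  measurable_fun setT f -> (forall x, 0 <= f x)%E ->
  (\int[lebesgue_measure]_x f (x + a)%R = \int[lebesgue_measure]_x f x)%E.
Proof.
move=> mf f0.
pose g : measurableTypeR R -> measurableTypeR R := fun x => x + a.
have mg : measurable_fun setT g by apply: measurable_funD.
have E A : measurable A -> lebesgue_measure A = pushforward lebesgue_measure g A.
  pose nu := measure_function_pushforward__canonical__measure_function_Measure
    (@lebesgue_measure R) mg.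
  apply: (@lebesgue_measure_unique R nu) => X [[x y] _ <-].
  rewrite /= /pushforward (_ : g @^-1` _ = `](x - a), (y - a)]%classic).
    rewrite !lebesgue_measure_itv/= !lte_fin ltrD2r.
    by case: ifP => // _; rewrite -!EFinB; congr EFin; ring.
  by apply/seteqP; split => z /=; rewrite !in_itv/= ltrBlDr lerBrDr.
transitivity (\int[pushforward lebesgue_measure g]_x f x)%E.
  by rewrite ge0_integral_pushforward.
by apply: eq_measure_integral => A mA _; exact/esym/E.
Qed.

(** By induction on the dimension, integrating over the first coordinate last. *)
Lemma lebesgue_rV_translation (R : realType) (n : nat) (a : 'rV[R]_n)
    (f : 'rV[R]_n -> \bar R) :
  measurable_fun setT f -> (forall x, 0 <= f x)%E ->
  (\int[lebesgue_rV R n]_x f (x + a)%R = \int[lebesgue_rV R n]_x f x)%E.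
Proof.
elim: n a f => [|n IH] a f mf f0.
  by apply: eq_integral => x _; congr f; apply/rowP => -[].
have step (h : 'rV[R]_n.+1 -> \bar R) : measurable_fun setT h ->
    (forall x, 0 <= h x)%E -> (\int[lebesgue_rV R n.+1]_x h x =
    \int[lebesgue_measure]_t \int[lebesgue_rV R n]_v h (rV_cons (t, v)))%E.
  move=> mh h0.
  transitivity (\int[(@lebesgue_measure R \x lebesgue_rV R n)%E]_z (h \o @rV_cons R n) z)%E.
    exact: (ge0_integral_pushforward (@measurable_rV_cons R n)).
  rewrite fubini_tonelli1//.
    by apply: measurableT_comp => //; exact: measurable_rV_cons.
  by move=> z; exact: h0.
have mt : measurable_fun setT (fun x : 'rV[R]_n.+1 => x + a).
  apply: measurable_fun_rV => i.
  rewrite (_ : (fun _ => _) = (fun x : 'rV[R]_n.+1 => x ord0 i + a ord0 i)).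
    by apply: measurable_funD => //; exact: measurable_rV_coord.
  by apply/funext => x; rewrite mxE.
rewrite step//; last exact: measurableT_comp.
rewrite step//.
have mc t : measurable_fun setT (fun v => f (rV_cons (t, v))).
  apply: measurableT_comp => //.
  by apply: measurableT_comp; [exact: measurable_rV_cons|exact: measurable_pair1].
have -> : (fun t => \int[lebesgue_rV R n]_v f (rV_cons (t, v) + a)%R)%E =
    (fun t => \int[lebesgue_rV R n]_v f (rV_cons ((t + a ord0 ord0)%R, v)))%E.
  apply/funext => t.
  rewrite -(IH (\row_i a ord0 (lift ord0 i)) (fun v => f (rV_cons ((t + a ord0 ord0)%R, v))))//.
  apply: eq_integral => v _; congr f; apply/rowP => i.
  have /(congr1 fst)/= h1 := rV_consK (t, v).
  have /(congr1 snd)/rowP/= h2 := rV_consK (t, v).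
  set v' := v + _; set t' := t + _.
  have /(congr1 fst)/= h3 := rV_consK (t', v').
  have /(congr1 snd)/rowP/= h4 := rV_consK (t', v').
  case: (unliftP ord0 i) => [j ->|->]; last first.
    by rewrite [LHS]mxE [X in X + _]h1 [RHS]h3.
  have E4 : rV_cons (t', v') 0 (lift ord0 j) = v' 0 j by have := h4 j; rewrite mxE.
  have E2 : rV_cons (t, v) 0 (lift ord0 j) = v 0 j by have := h2 j; rewrite mxE.
  by rewrite E4 [LHS]mxE E2 [RHS]mxE mxE.
apply: (@lebesgue_measure_translation R (a ord0 ord0)
  (fun t => \int[lebesgue_rV R n]_v f (rV_cons (t, v))))%E.
  apply: (@measurable_fun_fubini_tonelli_F _ _ _ _ _ _ (f \o @rV_cons R n)) => //.
  by apply: measurableT_comp => //; exact: measurable_rV_cons.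
  by move=> z; exact: f0.
by move=> t; apply: integral_ge0.
Qed.

(** * Continuous functions with bounded support *)

Section pointwise_continuity.
Variables (R : realType) (X : topologicalType).
Implicit Types f g : X -> R.

Lemma continuous_addf f g :
  continuous f -> continuous g -> continuous (fun x => f x + g x).
Proof. by move=> cf cg x; exact: (cvgD (cf x) (cg x)). Qed.

Lemma continuous_subf f g :
  continuous f -> continuous g -> continuous (fun x => f x - g x).
Proof. by move=> cf cg x; exact: (cvgB (cf x) (cg x)). Qed.

Lemma continuous_mulf f g :
  continuous f -> continuous g -> continuous (fun x => f x * g x).
Proof. by move=> cf cg x; exact: (cvgM (cf x) (cg x)). Qed.

End pointwise_continuity.

(** The norm is the sup norm; its closed balls being compact, [Cc] is the class of
    continuous functions with compact support. *)
Definition bounded_support (R : realType) n (f : 'rV[R]_n -> R) : Prop :=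
  exists M : R, forall x, M < `|x| -> f x = 0.

Definition Cc (R : realType) n (f : 'rV[R]_n -> R) : Prop :=
  continuous f /\ bounded_support f.

Section Cc.
Variables (R : realType) (n : nat).
Implicit Types f g : 'rV[R]_n -> R.

Definition I f : R := \int[lebesgue_rV R n]_x f x.

Lemma normr_coord_le (x : 'rV[R]_n) i : `|x ord0 i| <= `|x|.
Proof.
rewrite {2}/Num.norm/= mx_normrE.
by apply: (@le_trans _ _ `|x (ord0, i).1 (ord0, i).2|) => //; exact: le_bigmax.
Qed.

Lemma ball_compact (M : R) : compact [set x : 'rV[R]_n | `|x| <= M].
Proof.
apply: bounded_closed_compact.
  exists M; split => [|N]; first exact: num_real.
  by move=> MN x /= /le_trans; apply; exact: ltW.
apply: (@closed_comp _ _ (fun x : 'rV[R]_n => `|x|) [set y | y <= M]).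
  by move=> x _; exact: norm_continuous.
exact: closed_le.
Qed.

Lemma Cc_bounded f : Cc f -> exists2 K, 0 <= K & forall x, `|f x| <= K.
Proof.
move=> [cf [M fM]].
have cn : {within [set x : 'rV[R]_n | `|x| <= M], continuous (fun x => `|f x|)}.
  apply: continuous_subspaceT => x.
  by apply: (@continuous_comp _ _ _ f (fun y : R => `|y|)); [exact: cf|exact: norm_continuous].
have [[x0 x0M]|Mempty] := pselect ([set x : 'rV[R]_n | `|x| <= M] !=set0).
  have [c _ cmax] := compact_EVT_max (ex_intro _ x0 x0M) (@ball_compact M) cn.
  exists `|f c| => // x; have [xM|/fM ->] := leP `|x| M; last by rewrite normr0.
  by apply: cmax; rewrite inE.
exists 0 => // x; have [xM|/fM ->] := leP `|x| M; last by rewrite normr0.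
by exfalso; apply: Mempty; exists x.
Qed.

Lemma Cc_integrable f : Cc f -> (lebesgue_rV R n).-integrable setT (EFin \o f).
Proof.
move=> Cf; have [cf [M fM]] := Cf; have [K K0 fK] := Cc_bounded Cf.
pose B : set 'rV[R]_n := [set x | forall i, `[(- M), M]%classic (x ord0 i)].
have mB : measurable B.
  by apply: (@measurable_coord_box R n (fun=> `[(- M), M]%classic)) => i; exact: measurable_itv.
have mf := continuous_measurable_rV cf.
have -> : EFin \o f = (EFin \o f) \_ B.
  apply/funext => x; rewrite patchE; case: ifPn => //; rewrite notin_setE => xB /=.
  rewrite fM// ltNge; apply/negP => xM; apply: xB => i.
  by rewrite /= in_itv/= -ler_norml (le_trans (normr_coord_le _ _)).
apply/integrable_restrict => //; rewrite setTI.
apply: measurable_bounded_integrable => //.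
- pose J : set (measurableTypeR R) := `[(- M), M]%classic.
  apply: (@le_lt_trans _ _ (\prod_(i < n) lebesgue_measure J)%E).
    rewrite le_eqVlt; apply/orP; left; apply/eqP.
    by apply: (@lebesgue_rV_box R n (fun=> `[(- M), M]%classic)) => i; exact: measurable_itv.
  have [r ->] : exists r : R, lebesgue_measure J = r%:E.
    rewrite /J lebesgue_measure_itv/=; case: ifP => _; last by exists 0.
    by exists (M - - M); rewrite EFinB.
  by rewrite prodEFin ltry.
- exact: measurable_funTS.
- exists K; split => [|N KN x _]; first exact: num_real.
  exact: le_trans (fK x) (ltW KN).
Qed.

Lemma CcD f g : Cc f -> Cc g -> Cc (fun x => f x + g x).
Proof.
move=> [cf [M fM]] [cg [N gN]]; split; first exact: continuous_addf.
exists (Num.max M N) => x; rewrite gt_max => /andP[Mx Nx].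
by rewrite fM// gN// addr0.
Qed.

Lemma CcMl f g : Cc f -> continuous g -> Cc (fun x => g x * f x).
Proof.
move=> [cf [M fM]] cg; split; first exact: continuous_mulf.
by exists M => x Mx; rewrite fM// mulr0.
Qed.

Lemma CcMr f g : Cc f -> continuous g -> Cc (fun x => f x * g x).
Proof.
move=> [cf [M fM]] cg; split; first exact: continuous_mulf.
by exists M => x Mx; rewrite fM// mul0r.
Qed.

Lemma CcZ f k : Cc f -> Cc (fun x => k * f x).
Proof. by move=> Cf; apply: (@CcMl f (fun=> k)) => //; exact: cst_continuous. Qed.

Lemma CcN f : Cc f -> Cc (fun x => - f x).
Proof.
move=> /(CcZ (-1)); rewrite (_ : (fun x => -1 * f x) = (fun x => - f x))//.
by apply/funext => x; rewrite mulN1r.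
Qed.

Lemma Cc_sum (k : nat) (f : 'I_k -> 'rV[R]_n -> R) :
  (forall i, Cc (f i)) -> Cc (fun x => \sum_i f i x).
Proof.
elim: k f => [|k IH] f Cf.
  split; last by exists 0 => x _; rewrite big_ord0.
  rewrite (_ : (fun x => _) = (fun=> 0)); first exact: cst_continuous.
  by apply/funext => x; rewrite big_ord0.
have := CcD (Cf ord0) (IH (fun i => f (lift ord0 i)) (fun i => Cf _)).
congr Cc; apply/funext => x; by rewrite big_ord_recl.
Qed.

Lemma continuous_translation (a : 'rV[R]_n) : continuous (fun x : 'rV[R]_n => x + a).
Proof.
move=> x.
exact: (cvgD (@cvg_id _ (nbhs x)) (cvg_cst a)).
Qed.

Lemma continuous_shift f (a : 'rV[R]_n) : continuous f -> continuous (fun x : 'rV[R]_n => f (x + a)).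
Proof.
by move=> cf x; apply: (@continuous_comp _ _ _ (fun x : 'rV[R]_n => x + a) f);
  [exact: continuous_translation|exact: cf].
Qed.

Lemma Cc_shift f (a : 'rV[R]_n) : Cc f -> Cc (fun x : 'rV[R]_n => f (x + a)).
Proof.
move=> [cf [M fM]]; split; first exact: continuous_shift.
exists (M + `|a|) => x xM; apply: fM.
have := lerB_normD x a; move: xM; lra.
Qed.

Lemma ID f g : Cc f -> Cc g -> I (fun x => f x + g x) = I f + I g.
Proof. by move=> Cf Cg; rewrite /I RintegralD//; exact: Cc_integrable. Qed.

Lemma IZ f k : Cc f -> I (fun x => k * f x) = k * I f.
Proof. by move=> Cf; rewrite /I RintegralZl//; exact: Cc_integrable. Qed.

Lemma IN f : Cc f -> I (fun x => - f x) = - I f.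
Proof.
move=> Cf; rewrite -mulN1r -IZ//; congr I.
by apply/funext => x; rewrite mulN1r.
Qed.

Lemma I_sum (k : nat) (f : 'I_k -> 'rV[R]_n -> R) : (forall i, Cc (f i)) ->
  I (fun x => \sum_i f i x) = \sum_i I (f i).
Proof.
elim: k f => [|k IH] f Cf.
  rewrite big_ord0 /I (_ : (fun x => _) = cst 0) ?Rintegral_cst ?mul0r//.
  by apply/funext => x; rewrite big_ord0.
rewrite big_ord_recl -IH// -ID//; last by apply: Cc_sum.
by congr I; apply/funext => x; rewrite big_ord_recl.
Qed.

Lemma I_le f g : Cc f -> Cc g -> (forall x, f x <= g x) -> I f <= I g.
Proof. by move=> Cf Cg fg; apply: le_Rintegral => //; exact: Cc_integrable. Qed.

Lemma I_ge0 f : (forall x, 0 <= f x) -> 0 <= I f.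
Proof. by move=> f0; apply: Rintegral_ge0. Qed.

Lemma I_shift f (a : 'rV[R]_n) : Cc f -> I (fun x : 'rV[R]_n => f (x + a)) = I f.
Proof.
move=> Cf.
have mf := continuous_measurable_rV Cf.1.
rewrite /I /Rintegral; congr fine; rewrite integralE [RHS]integralE; congr (_ - _)%E.
- transitivity (\int[lebesgue_rV R n]_x ((EFin \o f)^\+ (x + a)%R))%E.
    by apply: eq_integral => x _; rewrite !funeposE.
  apply: (@lebesgue_rV_translation R n a ((EFin \o f)^\+)%E) => //.
  by apply: measurable_funepos; exact/measurable_EFinP.
- transitivity (\int[lebesgue_rV R n]_x ((EFin \o f)^\- (x + a)%R))%E.
    by apply: eq_integral => x _; rewrite !funenegE.
  apply: (@lebesgue_rV_translation R n a ((EFin \o f)^\-)%E) => //.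
  by apply: measurable_funeneg; exact/measurable_EFinP.
Qed.

Lemma I_EFin f : Cc f -> (\int[lebesgue_rV R n]_x (f x)%:E)%E = (I f)%:E.
Proof.
by move=> Cf; rewrite /I /Rintegral fineK//; apply: integrable_fin_num => //; exact: Cc_integrable.
Qed.

End Cc.

(** Heine's theorem, with only one of the two points confined to the compact. *)
Lemma heine (R : realType) (X : normedModType R) (f : X -> R) (K : set X) (e : R) :
  compact K -> (forall x, K x -> {for x, continuous f}) -> 0 < e ->
  exists2 r, 0 < r & forall x y, K x -> `|x - y| < r -> `|f x - f y| < e.
Proof.
move=> /compact_near_coveringP cK cf e0.
pose P (r : R) (x : X) := forall y, `|x - y| < r -> `|f x - f y| < e.
have : \forall r \near 0^'+, K `<=` P r.
  apply: cK => x Kx; have e20 : 0 < e / 2 by rewrite divr_gt0.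
  have /cvgrPdist_lt/(_ _ e20)/nbhs_ballP[r /= r0 rf] := cf x Kx.
  have r20 : 0 < r / 2 by rewrite divr_gt0.
  exists (ball x (r / 2), [set t | t < r / 2]) => /=.
    by split; [exact: nbhsx_ballx|exact: nbhs_right_lt].
  move=> [y t]/= []; rewrite -ball_normE/= => xy tr z yz.
  have fy : `|f x - f y| < e / 2 by apply: rf; rewrite -ball_normE/=; lra.
  have fz : `|f x - f z| < e / 2.
    apply: rf; rewrite -ball_normE/= (_ : x - z = (x - y) + (y - z)); last first.
      by rewrite addrA subrK.
    by apply: le_lt_trans (ler_normD _ _) _; lra.
  rewrite (_ : f y - f z = (f x - f z) - (f x - f y)); last by ring.
  by apply: le_lt_trans (ler_normB _ _) _; lra.
move=> near_P.
have near_Ppos : \forall r \near (0 : R)^'+, K `<=` P r /\ 0 < r.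
  by apply: filterI => //; exact: nbhs_right_gt.
have [r [Pr r0]] := @filter_ex _ _ (at_right_proper_filter (0 : R)) _ near_Ppos.
by exists r => // x y Kx; exact: Pr.
Qed.

(** * Euclidean norm *)

Lemma lipschitz_continuous (R : realType) (X : normedModType R) (f : X -> R) (L : R) :
  (forall x y, `|f x - f y| <= L * `|x - y|) -> continuous f.
Proof.
move=> Lf x; apply/cvgrPdist_lt => e e0.
have L0 : 0 < `|L| + 1 by rewrite ltr_wpDl.
apply/nbhs_ballP; exists (e / (`|L| + 1)); first by rewrite /= divr_gt0.
move=> y; rewrite -ball_normE/= ltr_pdivlMr// => xy.
apply: le_lt_trans xy; apply: le_trans (Lf x y) _.
apply: le_trans (ler_wpM2r (normr_ge0 _) (ler_norm L)) _.
by rewrite mulrC ler_wpM2l// lerDl.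
Qed.

Section enorm.
Variables (R : realType) (n : nat).
Implicit Types x y : 'rV[R]_n.

Definition dot x y : R := \sum_i x ord0 i * y ord0 i.

Lemma enorm_ge0 x : 0 <= enorm x.
Proof. exact: sqrtr_ge0. Qed.

Lemma sqr_enorm x : enorm x ^+ 2 = \sum_i x ord0 i ^+ 2.
Proof. by rewrite sqr_sqrtr// sumr_ge0// => i _; exact: sqr_ge0. Qed.

Lemma sqr_enorm_lin (a b : R) x y :
  enorm (a *: x + b *: y) ^+ 2 =
  a ^+ 2 * enorm x ^+ 2 + 2 * (a * b) * dot x y + b ^+ 2 * enorm y ^+ 2.
Proof.
rewrite !sqr_enorm /dot !mulr_sumr -!big_split/=; apply: eq_bigr => i _.
by rewrite !mxE; ring.
Qed.

Lemma enorm0_eq0 x : enorm x = 0 -> x = 0.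
Proof.
move=> x0; apply/rowP => i; rewrite mxE; apply/eqP.
have /eqP := sqr_enorm x; rewrite x0 expr0n/= eq_sym psumr_eq0; last first.
  by move=> j _; exact: sqr_ge0.
by move=> /allP/(_ i); rewrite mem_index_enum => /(_ isT); rewrite sqrf_eq0.
Qed.

Lemma dot_le x y : dot x y <= enorm x * enorm y.
Proof.
have [x0|xN] := eqVneq (enorm x) 0.
  rewrite x0 mul0r (enorm0_eq0 x0) /dot big1// => i _; by rewrite mxE mul0r.
have [y0|yN] := eqVneq (enorm y) 0.
  rewrite y0 mulr0 (enorm0_eq0 y0) /dot big1// => i _; by rewrite mxE mulr0.
have a0 : 0 < enorm x by rewrite lt_def xN enorm_ge0.
have b0 : 0 < enorm y by rewrite lt_def yN enorm_ge0.
have := sqr_enorm_lin (enorm y) (- enorm x) x y.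
set a := enorm x in a0 *; set b := enorm y in b0 *; set c := dot x y => E.
have := sqr_ge0 (enorm (b *: x + - a *: y)); rewrite E.
have -> : b ^+ 2 * a ^+ 2 + 2 * (b * - a) * c + (- a) ^+ 2 * b ^+ 2 =
  2 * (a * b) * (a * b - c) by ring.
by rewrite pmulr_rge0 ?subr_ge0// !mulr_gt0.
Qed.

Lemma enormD x y : enorm (x + y) <= enorm x + enorm y.
Proof.
rewrite -(@ler_pXn2r _ 2) ?nnegrE ?addr_ge0 ?enorm_ge0//.
have := sqr_enorm_lin 1 1 x y; rewrite !scale1r => ->.
by have := dot_le x y; lra.
Qed.

Lemma enormZ (a : R) x : enorm (a *: x) = `|a| * enorm x.
Proof.
apply/eqP; rewrite -(@eqrXn2 _ 2) ?mulr_ge0 ?enorm_ge0//; apply/eqP.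
have := sqr_enorm_lin a 0 x x; rewrite scale0r addr0 => ->.
by rewrite exprMn real_normK ?num_real//; ring.
Qed.

Lemma enormN x : enorm (- x) = enorm x.
Proof. by rewrite -scaleN1r enormZ normrN1 mul1r. Qed.

Lemma normr_le_enorm x : `|x| <= enorm x.
Proof.
rewrite {1}/Num.norm/= mx_normrE; apply: bigmax_le; first exact: enorm_ge0.
move=> [i j] _ /=; rewrite (ord1 i) -sqrtr_sqr ler_wsqrtr//.
by rewrite (bigD1 j)//= lerDl sumr_ge0// => k _; exact: sqr_ge0.
Qed.

Lemma enorm_le_normr x : enorm x <= n%:R * `|x|.
Proof.
apply: (@le_trans _ _ (\sum_i `|x ord0 i|)).
  rewrite -(@ler_pXn2r _ 2) ?nnegrE ?enorm_ge0 ?sumr_ge0// sqr_enorm.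
  rewrite expr2 mulr_suml ler_sum// => i _; rewrite -real_normK ?num_real// expr2.
  by rewrite ler_wpM2l// (bigD1 i)//= lerDl sumr_ge0.
apply: (@le_trans _ _ (\sum_(i < n) `|x|)).
  by apply: ler_sum => i _; exact: normr_coord_le.
by rewrite sumr_const card_ord mulr_natl.
Qed.

Lemma enorm_lipschitz_continuous (f : 'rV[R]_n -> R) (L : R) :
  (forall x y, `|f x - f y| <= L * enorm (x - y)) -> continuous f.
Proof.
move=> Lf; apply: (@lipschitz_continuous _ _ _ (`|L| * n%:R)) => x y.
apply: le_trans (Lf x y) _.
apply: le_trans (ler_wpM2r (enorm_ge0 _) (ler_norm L)) _.
by rewrite -mulrA ler_wpM2l// enorm_le_normr.
Qed.

Lemma enorm_lipschitz x y : `|enorm x - enorm y| <= enorm (x - y).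
Proof.
rewrite ler_norml; apply/andP; split.
  by have := enormD (y - x) x; rewrite subrK -(enormN (y - x)) opprB; lra.
by have := enormD (x - y) y; rewrite subrK; lra.
Qed.

Lemma enorm_continuous : continuous (@enorm R n).
Proof.
by apply: (@enorm_lipschitz_continuous _ 1) => x y; rewrite mul1r enorm_lipschitz.
Qed.

Lemma enorm_delta (i : 'I_n) : enorm (delta_mx ord0 i : 'rV[R]_n) = 1.
Proof.
apply/eqP; rewrite -(@eqrXn2 _ 2) ?enorm_ge0//; apply/eqP; rewrite sqr_enorm expr1n.
rewrite (bigD1 i)//= big1 => [|j ji]; first by rewrite mxE !eqxx expr1n addr0.
by rewrite mxE eqxx (negbTE ji)/= expr0n.
Qed.

Lemma dot_delta x (i : 'I_n) : dot x (delta_mx ord0 i) = x ord0 i.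
Proof.
rewrite /dot (bigD1 i)//= big1 => [|j ji]; first by rewrite mxE !eqxx mulr1 addr0.
by rewrite mxE eqxx (negbTE ji)/= mulr0.
Qed.

Lemma dotZr x (a : R) y : dot x (a *: y) = a * dot x y.
Proof. by rewrite /dot mulr_sumr; apply: eq_bigr => i _; rewrite mxE; ring. Qed.

Lemma dotZl x (a : R) y : dot (a *: x) y = a * dot x y.
Proof. by rewrite /dot mulr_sumr; apply: eq_bigr => i _; rewrite mxE; ring. Qed.

End enorm.

(** * The distance to the boundary of a convex set *)

Section distance.
Variables (R : realType) (n : nat) (Omega : set 'rV[R]_n).
Hypothesis Omega_open : open Omega.
Hypothesis Omega_convex : convex_set (Omega : set (convex_lmodType 'rV[R]_n)).
Hypothesis Omega_inradius : einradius Omega \is a fin_num.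
Implicit Types x y z w : 'rV[R]_n.

Lemma inradius_nonempty : Omega !=set0.
Proof.
apply/set0P/negP => /eqP O0; move: Omega_inradius.
by rewrite /einradius O0 image_set0 ereal_sup0.
Qed.

Lemma boundary_nonempty : boundary Omega !=set0.
Proof.
apply/set0P/negP => /eqP O0; move: Omega_inradius.
have [x Ox] := inradius_nonempty.
have : (edelta Omega x <= einradius Omega)%E by apply: ereal_sup_ubound; exists x.
by rewrite /edelta O0 image_set0 ereal_inf0 leye_eq => /eqP ->.
Qed.

Let Omega_sub_interior : Omega `<=` interior Omega.
Proof. by rewrite -open_subsetE. Qed.

Lemma boundary_notin y : boundary Omega y -> ~ Omega y.
Proof. by case=> _ yO /Omega_sub_interior. Qed.

Lemma edeltaE x : edelta Omega x = (delta Omega x)%:E.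
Proof.
have [y by_] := boundary_nonempty.
rewrite /delta fineK// ge0_fin_numE.
  by apply: le_lt_trans (ltry (enorm (x - y))); apply: ereal_inf_lbound; exists y.
by apply: le_ereal_inf_tmp => _ [z _ <-]; rewrite lee_fin enorm_ge0.
Qed.

Lemma delta_le x y : boundary Omega y -> delta Omega x <= enorm (x - y).
Proof.
by move=> by_; rewrite -lee_fin -edeltaE; apply: ereal_inf_lbound; exists y.
Qed.

Lemma le_delta x (r : R) :
  (forall y, boundary Omega y -> r <= enorm (x - y)) -> r <= delta Omega x.
Proof.
move=> rx; rewrite -lee_fin -edeltaE.
by apply: le_ereal_inf_tmp => _ [y by_ <-]; rewrite lee_fin rx.
Qed.

Lemma delta_ge0 x : 0 <= delta Omega x.
Proof. by apply: le_delta => y _; exact: enorm_ge0. Qed.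

Lemma delta_le_inradius x : Omega x -> delta Omega x <= inradius Omega.
Proof.
move=> Ox; rewrite -lee_fin -edeltaE /inradius fineK//.
by apply: ereal_sup_ubound; exists x.
Qed.

Lemma delta_gt0 x : Omega x -> 0 < delta Omega x.
Proof.
move=> Ox; have /nbhs_ballP[r /= r0 rO] := open_nbhs_nbhs (conj Omega_open Ox).
apply: (lt_le_trans r0); apply: le_delta => y /boundary_notin yO.
rewrite leNgt; apply/negP => xy; apply: yO; apply: rO.
by rewrite -ball_normE/=; apply: le_lt_trans xy; exact: normr_le_enorm.
Qed.

(** The last parameter for which the segment from [x] stays in [Omega] gives a
    boundary point. *)
Lemma segment_boundary x w : Omega x -> ~ Omega w ->
  exists2 y, boundary Omega y & enorm (x - y) <= enorm (x - w).
Proof.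
move=> Ox Ow; pose p (s : R) := x + s *: (w - x).
pose S : set R := [set s | 0 <= s <= 1 /\ Omega (p s)].
have S0 : S 0 by split; [rewrite lexx ler01|rewrite /p scale0r addr0].
have hS : has_sup S by split; [exists 0|exists 1 => s [/andP[]]].
have s0 : 0 <= sup S := sup_upper_bound hS S0.
have s1 : sup S <= 1 by apply: ge_sup; [exists 0|move=> s [/andP[]]].
have pB s t : p s - p t = (s - t) *: (w - x).
  by rewrite /p opprD addrACA subrr add0r -scalerBl.
pose N := `|w - x| + 1; have N0 : 0 < N by rewrite ltr_wpDl.
exists (p (sup S)); last first.
  rewrite (_ : x - _ = - (sup S *: (w - x))); last by rewrite /p opprD addrA subrr add0r.
  rewrite enormN enormZ -(enormN (x - w)) opprB ger0_norm//.
  by rewrite -[leRHS]mul1r ler_wpM2r ?enorm_ge0.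
split.
  move=> B /nbhs_ballP[r /= r0 rB].
  have [s Ss sr] := sup_adherent (divr_gt0 r0 N0) hS.
  exists (p s); split; first by have [] := Ss.
  apply: rB; rewrite -ball_normE/= pB normrZ.
  have sS := sup_upper_bound hS Ss.
  rewrite ger0_norm ?subr_ge0//; apply: (@le_lt_trans _ _ ((sup S - s) * N)).
    by rewrite ler_wpM2l ?subr_ge0// lerDl.
  by rewrite -ltr_pdivlMr//; lra.
move=> /interior_subset pO.
have s1' : sup S < 1.
  rewrite lt_neqAle s1 andbT; apply/eqP => E; apply: Ow; move: pO; rewrite E.
  by rewrite /p scale1r addrC subrK.
have /nbhs_ballP[r /= r0 rO] := open_nbhs_nbhs (conj Omega_open pO).
pose h := Num.min ((1 - sup S) / 2) (r / N / 2).
have h0 : 0 < h by rewrite lt_min !divr_gt0// subr_gt0.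
have h1 : h <= (1 - sup S) / 2 by rewrite ge_min lexx.
have h2 : h <= r / N / 2 by rewrite ge_min lexx orbT.
have : S (sup S + h).
  split; first by apply/andP; split; lra.
  apply: rO; rewrite -ball_normE/= pB normrZ opprD addrA subrr add0r normrN.
  rewrite gtr0_norm//; apply: (@le_lt_trans _ _ (h * N)).
    by rewrite ler_pM2l// lerDl.
  rewrite -ltr_pdivlMr//; apply: le_lt_trans h2 _.
  by rewrite ltr_pdivrMr// ltr_pMr ?divr_gt0// ltr1n.
by move=> /(sup_upper_bound hS); rewrite gerDl leNgt h0.
Qed.

(** Leaving [Omega] along a segment means crossing its boundary. *)
Lemma ball_sub x w : Omega x -> enorm (x - w) < delta Omega x -> Omega w.
Proof.
move=> Ox xw; apply: contrapT => /(segment_boundary Ox)[y /(delta_le x) + yw].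
by move=> /le_trans/(_ yw)/(lt_le_trans xw); rewrite ltxx.
Qed.

Lemma convex_comb x z (t : R) : Omega x -> Omega z -> 0 <= t <= 1 ->
  Omega ((1 - t) *: x + t *: z).
Proof.
move=> Ox Oz /andP[t0 t1].
have a0 : 0 <= 1 - t by lra.
have a1 : 1 - t <= 1 by lra.
have := @Omega_convex x z (Itv01 a0 a1); rewrite !inE => /(_ Ox Oz).
congr Omega; rewrite /conv/=; congr (_ + _ *: _).
by rewrite /unstable.onem opprB addrC subrK.
Qed.

(** The balls around [x] and [z] that touch the boundary span, together, a ball
    of the interpolated radius. *)
Lemma delta_concave x z (t : R) : Omega x -> Omega z -> 0 <= t <= 1 ->
  (1 - t) * delta Omega x + t * delta Omega z <=
  delta Omega ((1 - t) *: x + t *: z).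
Proof.
move=> Ox Oz t01; have /andP[t0 t1] := t01.
have dx := delta_gt0 Ox; have dz := delta_gt0 Oz.
set r := (1 - t) * _ + _.
have r0 : 0 < r.
  rewrite /r; have [->|tN] := eqVneq t 0; first by rewrite subr0 mul1r mul0r addr0.
  rewrite ltr_wpDl ?mulr_ge0 ?subr_ge0 ?(ltW dx)//.
  by rewrite mulr_gt0// lt_def tN.
apply: le_delta => y /boundary_notin yO; rewrite leNgt; apply/negP => wy; apply: yO.
set w := (1 - t) *: x + t *: z in wy *; pose v := y - w.
have vr : enorm v < r by rewrite -enormN opprB.
have inball u : Omega u -> Omega (u + (delta Omega u / r) *: v).
  move=> Ou; have du := delta_gt0 Ou; apply: (ball_sub Ou).
  rewrite opprD addrA subrr add0r enormN enormZ ger0_norm; last first.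
    by rewrite divr_ge0 ?ltW.
  by rewrite mulrAC ltr_pdivrMr// ltr_pM2l.
have := convex_comb (inball x Ox) (inball z Oz) t01.
congr Omega.
have E : (1 - t) * (delta Omega x / r) + t * (delta Omega z / r) = 1.
  by rewrite !mulrA -mulrDl mulfV// gt_eqF.
transitivity (w + ((1 - t) * (delta Omega x / r) + t * (delta Omega z / r)) *: v).
  by rewrite /w; apply/rowP => i; rewrite !mxE; ring.
by rewrite E scale1r /v addrC subrK.
Qed.

Lemma nearest_boundary x :
  exists2 y, boundary Omega y & enorm (x - y) = delta Omega x.
Proof.
have [y0 by0] := boundary_nonempty.
pose K := boundary Omega `&` [set y | enorm (x - y) <= enorm (x - y0)].
have cd : continuous (fun y => enorm (x - y)).
  apply: (@enorm_lipschitz_continuous _ _ _ 1) => y z; rewrite mul1r ler_norml; apply/andP; split.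
    have := enormD (x - y) (y - z); rewrite addrA subrK; lra.
  have := enormD (x - z) (z - y); rewrite addrA subrK -(enormN (z - y)) opprB; lra.
have cK : compact K.
  apply: bounded_closed_compact.
    exists (`|x| + enorm (x - y0)); split => [|N xN y [_ /= yx]]; first exact: num_real.
    have -> : y = x - (x - y) by rewrite opprB addrC subrK.
    apply: le_trans (ler_normB _ _) _; apply: le_trans (ltW xN); rewrite lerD2l.
    by apply: le_trans yx; exact: normr_le_enorm.
  apply: closedI.
    rewrite /boundary setDE; apply: closedI; first exact: closed_closure.
    by apply: open_closedC; exact: open_interior.
  apply: (@closed_comp _ _ (fun y => enorm (x - y)) [set r | r <= enorm (x - y0)]).
    by move=> y _; exact: cd.
  exact: closed_le.
have [|y] := EVT_min_rV _ cK (continuous_subspaceT cd); first by exists y0; split => /=.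
rewrite inE => -[by_ yx] ymin; exists y => //; apply/eqP; rewrite eq_le delta_le// andbT.
apply: le_delta => z bz; have [zx|/ltW] := leP (enorm (x - z)) (enorm (x - y0)).
  by apply: ymin; rewrite inE; split.
exact: le_trans.
Qed.

(** With [y] the boundary point nearest to [x], concavity bounds the distance
    at [x + t (z - x)] from below, while [enorm (x + t (z - x) - y)] bounds it
    from above; the derivatives at [t = 0] give the claim. *)
Lemma delta_touch x : Omega x ->
  exists2 e, enorm e = 1 &
    forall z, Omega z -> delta Omega z <= delta Omega x + dot e (z - x).
Proof.
move=> Ox; have [y by_ yd] := nearest_boundary x.
have d0 := delta_gt0 Ox; set d := delta Omega x in yd d0 *.
exists (d^-1 *: (x - y)).
  by rewrite enormZ yd ger0_norm ?mulVf ?gt_eqF// invr_ge0 ltW.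
move=> z Oz; set v := z - x; set dz := delta Omega z.
rewrite dotZl -lerBlDl ler_pdivlMl//; set c := dot _ v.
have dz0 : 0 < dz := delta_gt0 Oz.
have key t : 0 < t -> t <= 1 -> 2 * (d * (dz - d)) <= 2 * c + t * enorm v ^+ 2.
  move=> t0 t1; have t01 : 0 <= t <= 1 by rewrite ltW.
  have := le_trans (delta_concave Ox Oz t01) (delta_le _ by_).
  rewrite -/d -/dz.
  have -> : (1 - t) *: x + t *: z - y = 1 *: (x - y) + t *: v.
    by rewrite /v scale1r scalerBl scale1r scalerBr; apply/rowP => i; rewrite !mxE; ring.
  have l0 : 0 <= (1 - t) * d + t * dz.
    by apply: addr_ge0; apply: mulr_ge0; rewrite ?subr_ge0//; exact: ltW.
  rewrite -(@ler_pXn2r _ 2) ?nnegrE ?enorm_ge0// sqr_enorm_lin yd -/c => H.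
  rewrite -(ler_pM2l t0) -subr_ge0.
  have := sqr_ge0 (t * (dz - d)); move: H; rewrite -subr_ge0; lra.
rewrite leNgt; apply/negP => lt.
pose h := d * (dz - d) - c; have h0 : 0 < h by rewrite /h subr_gt0.
have V0 : 0 <= enorm v ^+ 2 by rewrite sqr_ge0.
pose t := Num.min 1 (h / (enorm v ^+ 2 + 1)).
have t0 : 0 < t by rewrite lt_min ltr01 divr_gt0// ltr_wpDl.
have t1 : t <= 1 by rewrite ge_min lexx.
have th : t * (enorm v ^+ 2 + 1) <= h.
  by rewrite -ler_pdivlMr ?ltr_wpDl// ge_min lexx orbT.
have := key t t0 t1; move: th; rewrite /h; lra.
Qed.

(** The distance to the boundary, extended by 0 outside of [Omega], so that it is
    Lipschitz on the whole space. *)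
Definition depth x : R := if pselect (Omega x) then delta Omega x else 0.

Lemma depthE x : Omega x -> depth x = delta Omega x.
Proof. by rewrite /depth; case: pselect. Qed.

Lemma depth_out x : ~ Omega x -> depth x = 0.
Proof. by rewrite /depth; case: pselect. Qed.

Lemma depth_ge0 x : 0 <= depth x.
Proof. by rewrite /depth; case: pselect => //= _; exact: delta_ge0. Qed.

Lemma depth_gt0 x : 0 < depth x -> Omega x.
Proof. by rewrite /depth; case: pselect => //= _; rewrite ltxx. Qed.

Lemma inradius_gt0 : 0 < inradius Omega.
Proof.
have [x Ox] := inradius_nonempty.
exact: lt_le_trans (delta_gt0 Ox) (delta_le_inradius Ox).
Qed.

Lemma depth_le_inradius x : depth x <= inradius Omega.
Proof.
rewrite /depth; case: pselect => /= [Ox|_]; first exact: delta_le_inradius.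
exact/ltW/inradius_gt0.
Qed.

Lemma depth_le x y : depth x <= depth y + enorm (x - y).
Proof.
have [Ox|Ox] := pselect (Omega x); last first.
  by rewrite depth_out// addr_ge0 ?enorm_ge0 ?depth_ge0.
have [Oy|Oy] := pselect (Omega y).
  rewrite !depthE// -lerBlDr; apply: le_delta => z bz; rewrite lerBlDr.
  apply: le_trans (delta_le x bz) _.
  by have := enormD (y - z) (x - y); rewrite [y - z + _]addrC addrA subrK.
rewrite (depth_out Oy) add0r depthE// leNgt; apply/negP => /(ball_sub Ox).
exact: Oy.
Qed.

Lemma depth_lipschitz x y : `|depth x - depth y| <= enorm (x - y).
Proof.
rewrite ler_norml; apply/andP; split; last by have := depth_le x y; lra.
by have := depth_le y x; rewrite -(enormN (y - x)) opprB; lra.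
Qed.

Lemma depth_continuous : continuous depth.
Proof.
by apply: (@enorm_lipschitz_continuous _ _ _ 1) => x y; rewrite mul1r depth_lipschitz.
Qed.

End distance.

(** * Concave functions of the distance *)

(** [W] is concave and nondecreasing, and [B] bounds [- W''] from below. *)
Section profile.
Variables (R : realType) (W V B : R -> R) (d : R).
Hypothesis DW : forall s : R, 0 < s < d -> is_derive s (1 : R) W (V s).
Hypothesis V_ge0 : forall s : R, 0 < s < d -> 0 <= V s.
Hypothesis DV : forall s : R, 0 < s < d ->
  exists2 dV, is_derive s (1 : R) V dV & dV <= - B s.
Hypothesis B_ge0 : forall s : R, 0 < s < d -> 0 <= B s.
Hypothesis B_continuous : forall s : R, 0 < s < d -> {for s, continuous B}.

Lemma W_MVT (s t : R) : 0 < s -> s < t -> t < d ->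
  exists2 c, s < c < t & W t - W s = V c * (t - s).
Proof.
move=> s0 st td.
have [u|u|c cst E] := @MVT R W V s t st.
- by rewrite in_itv/= => /andP[su ut]; apply: DW; lra.
- apply: derivable_within_continuous => v; rewrite in_itv/= => /andP[sv vt].
  by have [] := DW (_ : 0 < v < d); first lra.
by exists c => //; move: cst; rewrite in_itv.
Qed.

Lemma V_MVT (s t : R) : 0 < s -> s < t -> t < d ->
  exists2 c, s < c < t & V t - V s <= - B c * (t - s).
Proof.
move=> s0 st td.
have DV' u : 0 < u < d -> is_derive u (1 : R) V ('D_1 V u).
  by move=> /DV[dV [D E] _]; split.
have [u|u|c cst E] := @MVT R V ('D_1 V) s t st.
- by rewrite in_itv/= => /andP[su ut]; apply: DV'; lra.
- apply: derivable_within_continuous => v; rewrite in_itv/= => /andP[sv vt].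
  by have [] := DV' v (_ : 0 < v < d); first lra.
move: cst; rewrite in_itv/= => /andP[sc ct]; exists c; first by rewrite sc.
rewrite E ler_wpM2r ?subr_ge0 ?(ltW st)//.
have [|dV [_ ->] //] := DV (_ : 0 < c < d); lra.
Qed.

Lemma V_antitone (s t : R) : 0 < s -> s <= t -> t < d -> V t <= V s.
Proof.
move=> s0; rewrite le_eqVlt => /predU1P[-> //|st] td.
have [c /andP[sc ct]] := V_MVT s0 st td.
have : 0 <= B c * (t - s) by rewrite mulr_ge0 ?B_ge0//; lra.
lra.
Qed.

Lemma W_monotone (s t : R) : 0 < s -> s <= t -> t < d -> W s <= W t.
Proof.
move=> s0; rewrite le_eqVlt => /predU1P[-> //|st] td.
have [c /andP[sc ct] E] := W_MVT s0 st td.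
by rewrite -subr_ge0 E mulr_ge0 ?V_ge0//; lra.
Qed.

Lemma W_tangent (s a : R) : 0 < s < d -> 0 < s + a < d -> W (s + a) - W s <= a * V s.
Proof.
move=> /andP[s0 sd] /andP[sa0 sad]; have [a0|a0|->] := ltgtP a 0.
- have [|c /andP[c1 c2]] := W_MVT sa0 (_ : s + a < s) sd; first lra.
  have := V_antitone (lt_trans sa0 c1) (ltW c2) sd.
  rewrite opprD addNKr => Vc E.
  have : 0 <= (V c - V s) * - a by rewrite mulr_ge0; lra.
  lra.
- have [|c /andP[c1 c2]] := W_MVT s0 (_ : s < s + a) sad; first lra.
  have := V_antitone s0 (ltW c1) (lt_trans c2 sad).
  rewrite addrAC subrr add0r => Vc E.
  have : 0 <= (V s - V c) * a by rewrite mulr_ge0; lra.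
  lra.
- by rewrite addr0 subrr mul0r.
Qed.

Lemma W_lipschitz (s t u : R) : 0 < s -> s <= t -> t < d -> s <= u -> u < d ->
  `|W t - W u| <= V s * `|t - u|.
Proof.
move=> s0; wlog tu : t u / u <= t.
  move=> H st td su ud; have [ut|/ltW tu] := leP u t; first exact: H.
  by rewrite distrC (distrC t) H.
move=> st td su ud; rewrite !ger0_norm ?subr_ge0//; last exact: W_monotone (lt_le_trans s0 su) tu td.
have := @W_tangent u (t - u); rewrite addrC subrK => /(_ _ _)/le_trans; apply; [lra|lra|].
by rewrite mulrC ler_wpM2r ?subr_ge0//; exact: V_antitone.
Qed.

(** A symmetric second difference is an integral of [V'], which is at most [- B];
    uniform continuity of [B] replaces the integrand by its value at the centre. *)
Lemma W_second_difference (s1 s2 e : R) : 0 < s1 -> s2 < d -> 0 < e ->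
  exists2 r, 0 < r & forall s a : R, s1 <= s <= s2 -> `|a| < r ->
    W (s + a) + W (s - a) - 2 * W s <= - (a ^+ 2 * (B s - e)).
Proof.
move=> s10 s2d e0.
have [r0 r00 Br] : exists2 r, 0 < r & forall x y : R, `[s1, s2]%classic x ->
    `|x - y| < r -> `|B x - B y| < e.
  apply: heine => // [|x]; first exact: segment_compact.
  by rewrite /= in_itv/= => /andP[sx xs]; apply: B_continuous; lra.
pose r := Num.min r0 (Num.min s1 (d - s2)).
have rr0 : r <= r0 by rewrite ge_min lexx.
have rs1 : r <= s1 by rewrite !ge_min lexx orbT.
have rs2 : r <= d - s2 by rewrite !ge_min lexx !orbT.
exists r; first by rewrite !lt_min r00 s10 subr_gt0.
move=> s a /andP[s1s ss2].
wlog a0 : a / 0 <= a.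
  move=> H ar; have [/H/(_ ar) //|/ltW a0] := leP 0 a.
  by have := H (- a); rewrite normrN oppr_ge0 sqrrN opprK (addrC (W _)) => /(_ a0 ar).
rewrite ger0_norm// => ar; move: a0; rewrite le_eqVlt => /predU1P[<-|a0].
  by rewrite addr0 subr0 expr0n/= mul0r; lra.
pose k u := W (s + u) + W (s - u) + u ^+ 2 * (B s - e).
have Dk u : 0 <= u <= a ->
    is_derive u (1 : R) k (V (s + u) - V (s - u) + 2 * u * (B s - e)).
  move=> /andP[u0 ua].
  have D1 : is_derive u (1 : R) (fun u => W (s + u)) (V (s + u)).
    have D0 : is_derive u (1 : R) (fun u : R => s + u) 1.
      apply: (is_derive_eq (is_deriveD (is_derive_cst s u 1) (is_derive_id u 1))).
      by rewrite add0r.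
    have D := DW (_ : 0 < s + u < d).
    have /= := @is_derive1_comp R W (fun u : R => s + u) u _ _ (D _) D0.
    by rewrite mulr1; apply; lra.
  have D2 : is_derive u (1 : R) (fun u => W (s - u)) (- V (s - u)).
    have D0 : is_derive u (1 : R) (fun u : R => s - u) (-1).
      apply: (is_derive_eq (is_deriveB (is_derive_cst s u 1) (is_derive_id u 1))).
      by rewrite sub0r.
    have D := DW (_ : 0 < s - u < d).
    have /= := @is_derive1_comp R W (fun u : R => s - u) u _ _ (D _) D0.
    by rewrite mulrN1; apply; lra.
  by apply: is_derive_eq; rewrite /GRing.scale/=; ring.
have [u|u|c] := @MVT R k (fun u => V (s + u) - V (s - u) + 2 * u * (B s - e)) 0 a a0.
- by rewrite in_itv/= => /andP[/ltW u0 /ltW ua]; apply: Dk; rewrite u0.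
- apply: derivable_within_continuous => v; rewrite in_itv/= => va.
  by have [] := Dk v va.
rewrite in_itv/= => /andP[c0 ca]; rewrite /k addr0 !subr0 expr0n/= mul0r addr0 => E.
have [|||x /andP[x1 x2]] := @V_MVT (s - c) (s + c); try lra.
have /ltr_normlP[_ Bx] : `|B s - B x| < e.
  apply: Br; first by rewrite /= in_itv/= s1s.
  by rewrite ltr_norml; apply/andP; split; lra.
move=> Vc.
have : 0 <= (B x - (B s - e)) * (2 * c) by rewrite mulr_ge0; lra.
move=> H1; have : (V (s + c) - V (s - c) + 2 * c * (B s - e)) * a <= 0.
  by rewrite pmulr_lle0//; lra.
lra.
Qed.

End profile.

(** * The weighted L^1 inequality *)

(** Discrete integration by parts, from the translation invariance of the
    integral. *)
Lemma I_second_difference (R : realType) (n : nat) (f phi : 'rV[R]_n -> R)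
    (a : 'rV[R]_n) : Cc f -> continuous phi ->
  I (fun x => f x * (phi (x + a) + phi (x - a) - 2 * phi x)) =
  - I (fun x => (f (x + a) - f x) * (phi (x + a) - phi x)).
Proof.
move=> Cf cphi.
have cpa := continuous_shift (a := a) cphi; have cpb := continuous_shift (a := - a) cphi.
have Cfa := @Cc_shift R n f a Cf.
pose p1 := fun x => f x * phi (x + a); pose p2 := fun x => f x * phi (x - a).
pose p3 := fun x => f x * phi x; pose p4 := fun x => f (x + a) * phi x.
pose p5 := fun x => f (x + a) * phi (x + a).
have C1 : Cc p1 by exact: CcMr.
have C2 : Cc p2 by exact: CcMr.
have C3 : Cc p3 by exact: CcMr.
have C4 : Cc p4 by exact: CcMr.
have C5 : Cc p5 by exact: CcMr.
have E5 : I p5 = I p3 by rewrite -(@I_shift R n p3 a C3).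
have E4 : I p4 = I p2.
  rewrite -(@I_shift R n p2 a C2); congr I; apply/funext => x.
  by rewrite /p2 /p4 addrK.
transitivity (I p1 + I p2 + (- 2) * I p3).
  rewrite -IZ// -!ID//; [|exact: CcD|exact: CcZ].
  by congr I; apply/funext => x; rewrite /p1 /p2 /p3; ring.
transitivity (- (I p5 + - I p1 + (- I p4 + I p3))); first by rewrite E5 E4; ring.
congr (- _); rewrite -!IN// -!ID//; try by do ?[apply: CcD|apply: CcN].
by congr I; apply/funext => x; rewrite /p1 /p3 /p4 /p5; ring.
Qed.

Section weighted_L1.
Variables (R : realType) (n : nat) (Omega : set 'rV[R]_n).
Hypothesis Omega_open : open Omega.
Hypothesis Omega_convex : convex_set (Omega : set (convex_lmodType 'rV[R]_n)).
Hypothesis Omega_inradius : einradius Omega \is a fin_num.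
Variables (W V B : R -> R) (d : R).
Hypothesis d_gt : inradius Omega < d.
Hypothesis DW : forall s : R, 0 < s < d -> is_derive s (1 : R) W (V s).
Hypothesis V_ge0 : forall s : R, 0 < s < d -> 0 <= V s.
Hypothesis DV : forall s : R, 0 < s < d ->
  exists2 dV, is_derive s (1 : R) V dV & dV <= - B s.
Hypothesis B_ge0 : forall s : R, 0 < s < d -> 0 <= B s.
Hypothesis B_continuous : forall s : R, 0 < s < d -> {for s, continuous B}.
Variable s : R.
Hypothesis s_gt0 : 0 < s.
Hypothesis s_le : s <= inradius Omega.

Let e_ (i : 'I_n) : 'rV[R]_n := delta_mx ord0 i.

(** Bounded away from 0, so that the singular weights composed with it are
    continuous; equal to the distance where that is at least [s]. *)
Definition clamped_depth x : R := Num.max (depth Omega x) s.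

Let rho := clamped_depth.

Let depth_lip := depth_lipschitz Omega_open Omega_inradius.

Let rho_ge x : s <= rho x.
Proof. by rewrite /rho /clamped_depth le_max lexx orbT. Qed.

Let rho_le x : rho x <= inradius Omega.
Proof. by rewrite /rho /clamped_depth ge_max s_le depth_le_inradius. Qed.

Let rho_in x : 0 < rho x < d.
Proof.
by rewrite (lt_le_trans s_gt0 (rho_ge x))/= (le_lt_trans (rho_le x)).
Qed.

Let rhoE x : s <= depth Omega x -> rho x = depth Omega x.
Proof. by move=> sx; rewrite /rho /clamped_depth max_l. Qed.

Let rho_lip x y : `|rho x - rho y| <= enorm (x - y).
Proof.
have := depth_lip x y; rewrite /rho /clamped_depth !ler_norml => /andP[h1 h2].
by rewrite !maxEle; case: ifP; case: ifP => *; apply/andP; split; lra.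
Qed.

Lemma clamped_depth_continuous : continuous clamped_depth.
Proof.
by apply: (@enorm_lipschitz_continuous _ _ _ 1) => x y; rewrite mul1r rho_lip.
Qed.

Lemma continuous_comp_depth (f : R -> R) :
  (forall u : R, 0 < u < d -> {for u, continuous f}) ->
  continuous (fun x => f (clamped_depth x)).
Proof.
move=> cf x; apply: (@continuous_comp _ _ _ clamped_depth f).
  exact: clamped_depth_continuous.
exact/cf/rho_in.
Qed.

Let phi x := W (rho x).

Let phi_continuous : continuous phi.
Proof.
by apply: continuous_comp_depth => u ud; exact: is_derive_continuous_at (DW ud).
Qed.

Let V_continuous : continuous (fun x => V (rho x)).
Proof.
apply: continuous_comp_depth => u /DV[dV D _]; exact: is_derive_continuous_at D.
Qed.

Let Brho_continuous : continuous (fun x => B (rho x)).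
Proof. exact: continuous_comp_depth. Qed.

Let S i t x := phi (x + t *: e_ i) + phi (x - t *: e_ i) - 2 * phi x.

Let phi_lip x y : `|phi x - phi y| <= V s * enorm (x - y).
Proof.
apply: le_trans (W_lipschitz DW V_ge0 DV B_ge0 s_gt0 _ _ _ _) _ => //.
- by have /andP[] := rho_in x.
- by have /andP[] := rho_in y.
- by rewrite ler_wpM2l// V_ge0// s_gt0 (le_lt_trans s_le).
Qed.

(* Near x, the function phi z lies below W (depth x + dot e (z - x)) and agrees with
   it at z = x, where e is given by delta_touch. So the second difference of phi
   along the i-th axis is at most that of W with step t * e ord0 i, and the squares
   of the e ord0 i add up to 1. The second claim compares the first difference of
   phi with its linear part: the error is again controlled by S, as both one-sided
   errors have the same sign. *)
Let touch (eps : R) : 0 < eps -> exists2 r, 0 < r & forall t x, 0 < t < r ->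
  2 * s < depth Omega x ->
  exists e : 'rV[R]_n, [/\ enorm e = 1,
    forall i, S i t x <= 0 /\
      0 <= t * e ord0 i * V (rho x) - (phi (x + t *: e_ i) - phi x) <= - S i t x &
    \sum_i S i t x <= - (t ^+ 2 * (B (rho x) - eps))].
Proof.
move=> eps0.
have [r1 r10 r1P] := W_second_difference DW DV B_continuous s_gt0 d_gt eps0.
pose r := Num.min r1 (Num.min s (d - inradius Omega)).
have rr1 : r <= r1 by rewrite ge_min lexx.
have rs : r <= s by rewrite !ge_min lexx orbT.
have rd : r <= d - inradius Omega by rewrite !ge_min lexx !orbT.
exists r; first by rewrite !lt_min r10 s_gt0 subr_gt0.
move=> t x /andP[t0 tr] sx.
have Ox : Omega x by apply: depth_gt0; lra.
have [e e1 eP] := delta_touch Omega_open Omega_convex Omega_inradius Ox.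
have ei i : `|e ord0 i| <= 1.
  by rewrite -e1 (le_trans (normr_coord_le _ _))// normr_le_enorm.
have near a i : `|a| = t -> s < depth Omega (x + a *: e_ i).
  move=> at_; have := depth_lip x (x + a *: e_ i).
  rewrite opprD addrA subrr add0r enormN enormZ enorm_delta mulr1 at_.
  by rewrite ler_norml => /andP[_]; lra.
have rhox : rho x = depth Omega x by apply: rhoE; lra.
have [rx0 rxd] : 2 * s < rho x /\ rho x <= inradius Omega by rewrite rho_le rhox.
have tei a i : `|a| = t -> `|a * e ord0 i| <= t.
  by move=> at_; rewrite normrM at_ ler_piMr// ltW.
have up a i : `|a| = t -> phi (x + a *: e_ i) <= W (rho x + a * e ord0 i).
  move=> at_; have ss := near a i at_.
  have Oa : Omega (x + a *: e_ i) by apply: depth_gt0; lra.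
  have := tei a i at_; rewrite ler_norml => /andP[ta1 ta2].
  apply: (W_monotone DW V_ge0); [exact: lt_le_trans (rho_ge _)| |lra].
  rewrite (rhoE (ltW ss)) rhox !depthE//.
  have := eP _ Oa; rewrite (_ : x + a *: e_ i - x = a *: e_ i) ?dotZr ?dot_delta//.
  by rewrite addrAC subrr add0r.
have nt : `|t| = t by rewrite ger0_norm// ltW.
have nt' : `|- t| = t by rewrite normrN.
have tang a i : `|a| = t -> phi (x + a *: e_ i) - phi x <= a * e ord0 i * V (rho x).
  move=> at_; have := tei a i at_; rewrite ler_norml => /andP[ta1 ta2].
  have := up a i at_.
  have : W (rho x + a * e ord0 i) - W (rho x) <= a * e ord0 i * V (rho x).
    by apply: (W_tangent DW DV B_ge0); [exact: rho_in|apply/andP; split; lra].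
  rewrite /phi; lra.
exists e; split => // [i|].
  have := tang t i nt; have := tang (- t) i nt'.
  by rewrite /S scaleNr mulNr => h1 h2; split; [lra|apply/andP; split; lra].
apply: (@le_trans _ _ (\sum_i - ((t * e ord0 i) ^+ 2 * (B (rho x) - eps)))).
  apply: ler_sum => i _; rewrite /S.
  have := up t i nt; have := up (- t) i nt'; rewrite scaleNr mulNr => h1 h2.
  have := r1P (rho x) (t * e ord0 i); rewrite rho_ge rho_le => /(_ isT).
  have := tei t i nt => h3 /(_ (le_lt_trans h3 _)) h4.
  have := h4 (lt_le_trans tr rr1); have -> : phi x = W (rho x) by []; lra.
rewrite sumrN -mulr_suml; under eq_bigr do rewrite exprMn.
by rewrite -mulr_sumr -sqr_enorm e1 expr1n mulr1.
Qed.

(** In the application [h] is [|g|^p], while [H i] and [Hn] are the moduli of its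
    [i]-th partial derivative and of its gradient; [h_diff] bounds difference
    quotients only from above, so that [h] need not be differentiable. The factor 4
    in [h_supp] leaves room for a cutoff between the support of [h] and the points
    where [clamped_depth] differs from the distance. *)
Variables (h Hn : 'rV[R]_n -> R) (H : 'I_n -> 'rV[R]_n -> R) (M : R).
Hypothesis Ch : Cc h.
Hypothesis h_ge0 : forall x, 0 <= h x.
Hypothesis h_supp : forall x, h x != 0 -> 4 * s <= depth Omega x /\ enorm x <= M.
Hypothesis CH : forall i, Cc (H i).
Hypothesis H_ge0 : forall i x, 0 <= H i x.
Hypothesis CHn : Cc Hn.
Hypothesis Hn_ge0 : forall x, 0 <= Hn x.
Hypothesis Hn_ge : forall e x, enorm e = 1 -> \sum_i H i x * `|e ord0 i| <= Hn x.
Hypothesis h_diff : forall eps : R, 0 < eps -> exists2 r, 0 < r &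
  forall t x i, 0 < t < r -> `|h (x + t *: e_ i) - h x| <= t * (H i x + eps).

(* At least 1 near the support of h, and supported in a bounded part of Omega. *)
Let chi (x : 'rV[R]_n) : R := Num.max 0 (Num.min (depth Omega x - 2 * s) (M + 2 * s - enorm x) / s).

(* At least 1 near the support of chi. *)
Let psi (x : 'rV[R]_n) : R := Num.max 0 ((M + 4 * s - enorm x) / s).

Let chi_ge0 x : 0 <= chi x.
Proof. by rewrite /chi le_max lexx. Qed.

Let chi_supp x : chi x != 0 -> 2 * s < depth Omega x /\ enorm x < M + 2 * s.
Proof.
rewrite /chi maxElt; case: ifP => [+ _|]; last by rewrite eqxx.
by rewrite pmulr_lgt0 ?invr_gt0// lt_min !subr_gt0 => /andP[].
Qed.

Let chi_lip x y : `|chi x - chi y| <= enorm (x - y) / s.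
Proof.
have lip_max (u v l : R) : `|u - v| <= l -> `|Num.max 0 u - Num.max 0 v| <= l.
  rewrite !maxEle !ler_norml => /andP[h1 h2].
  by case: ifP; case: ifP => *; apply/andP; split; lra.
have lip_min (u v u' v' l : R) : `|u - u'| <= l -> `|v - v'| <= l ->
    `|Num.min u v - Num.min u' v'| <= l.
  rewrite !minEle !ler_norml => /andP[h1 h2] /andP[h3 h4].
  by case: ifP; case: ifP => *; apply/andP; split; lra.
apply: lip_max; rewrite -mulrBl normrM (ger0_norm (x := s^-1)); last first.
  by rewrite invr_ge0 ltW.
rewrite ler_pM2r ?invr_gt0//; apply: lip_min.
  by rewrite opprB addrA subrK depth_lip.
by rewrite opprB addrA -(addrA _ (- enorm x)) addrAC opprD addrA;
  have := enorm_lipschitz y x; rewrite -(enormN (y - x)) opprB; congr (`|_| <= _); ring.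
Qed.

Let enorm_bounded_support (f : 'rV[R]_n -> R) (N : R) :
  (forall x, N < enorm x -> f x = 0) -> bounded_support f.
Proof.
by move=> fN; exists N => x Nx; apply: fN; apply: lt_le_trans Nx _; exact: normr_le_enorm.
Qed.

Let Cchi : Cc chi.
Proof.
split.
  by apply: (@enorm_lipschitz_continuous _ _ _ s^-1) => x y; rewrite mulrC; exact: chi_lip.
apply: (@enorm_bounded_support _ (M + 2 * s)) => x Mx; apply/eqP/negPn/negP.
by move=> /chi_supp[_]; rewrite ltNge (ltW Mx).
Qed.

Let psi_ge0 x : 0 <= psi x.
Proof. by rewrite /psi le_max lexx. Qed.

Let Cpsi : Cc psi.
Proof.
split.
  apply: (@enorm_lipschitz_continuous _ _ _ s^-1) => x y.
  have := enorm_lipschitz x y; rewrite /psi.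
  have s0 : 0 < s^-1 by rewrite invr_gt0.
  have -> : (M + 4 * s - enorm x) / s = s^-1 * (M + 4 * s - enorm x) by rewrite mulrC.
  have -> : (M + 4 * s - enorm y) / s = s^-1 * (M + 4 * s - enorm y) by rewrite mulrC.
  rewrite -[0](mulr0 s^-1) -!maxr_pMr ?(ltW s0)// -mulrBr normrM (gtr0_norm s0).
  rewrite ler_pM2l// !maxEle !ler_norml => /andP[h1 h2].
  by case: ifP; case: ifP => *; apply/andP; split; lra.
apply: (@enorm_bounded_support _ (M + 4 * s)) => x Mx; rewrite /psi max_l//.
by rewrite pmulr_lle0 ?invr_gt0// subr_le0 ltW.
Qed.

Let psi_ge1 x : enorm x <= M + 3 * s -> 1 <= psi x.
Proof.
by move=> xM; rewrite /psi le_max ler_pdivlMr// mul1r; apply/orP; right; lra.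
Qed.

Let chi_ge1 x : 3 * s <= depth Omega x -> enorm x <= M + s -> 1 <= chi x.
Proof.
move=> dx xM; rewrite /chi le_max; apply/orP; right.
by rewrite ler_pdivlMr// mul1r le_min; apply/andP; split; lra.
Qed.

Let CS i t : continuous (S i t).
Proof.
have c1 := continuous_shift (a := t *: e_ i) phi_continuous.
have c2 := continuous_shift (a := - (t *: e_ i)) phi_continuous.
apply: continuous_subf; first exact: continuous_addf.
by apply: continuous_mulf; [exact: cst_continuous|exact: phi_continuous].
Qed.

Let enorm_step t i : 0 < t -> enorm (t *: e_ i) = t.
Proof. by move=> t0; rewrite enormZ enorm_delta mulr1 gtr0_norm. Qed.

Let chi_step t x i : 0 < t < s ->
  (chi (x + t *: e_ i) - chi x) * (phi (x + t *: e_ i) - phi x) <=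
  t ^+ 2 * (V s / s) * psi x.
Proof.
move=> /andP[t0 ts].
have Vs : 0 <= V s by apply: V_ge0; rewrite s_gt0 (le_lt_trans s_le).
have dx : x + t *: e_ i - x = t *: e_ i by rewrite addrAC subrr add0r.
have [E|xM] := leP (enorm x) (M + 3 * s); last first.
  have chi0 y : M + 2 * s <= enorm y -> chi y = 0.
    by move=> yM; apply/eqP/negPn/negP => /chi_supp[_]; rewrite ltNge yM.
  rewrite !chi0; last first; [|lra|].
    have := enorm_lipschitz x (x + t *: e_ i).
    rewrite opprD addrA subrr add0r enormN enorm_step// ler_norml => /andP[_]; lra.
  by rewrite subrr mul0r !mulr_ge0 ?sqr_ge0 ?invr_ge0 ?psi_ge0// ltW.
apply: le_trans (ler_norm _) _; rewrite normrM.
apply: (@le_trans _ _ (t / s * (V s * t))).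
  apply: ler_pM => //.
    by apply: le_trans (chi_lip _ _) _; rewrite dx enorm_step.
  by apply: le_trans (phi_lip _ _) _; rewrite dx enorm_step.
have -> : t / s * (V s * t) = t ^+ 2 * (V s / s) * 1 by rewrite mulr1; ring.
apply: ler_wpM2l; last exact: psi_ge1.
by rewrite !mulr_ge0 ?sqr_ge0 ?invr_ge0// ltW.
Qed.

Let I_chi_S t i : 0 < t < s ->
  I (fun x => chi x * - S i t x) <= t ^+ 2 * (V s / s) * I psi.
Proof.
move=> ts.
have CchiS : Cc (fun x => chi x * S i t x) by apply: CcMr => //; exact: CS.
rewrite (_ : (fun x => _) = (fun x => - (chi x * S i t x))); last first.
  by apply/funext => x; rewrite mulrN.
rewrite IN// /S I_second_difference// opprK -IZ//; apply: I_le.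
- apply: CcMr.
    by apply: CcD; [exact: Cc_shift|exact: CcN].
  apply: continuous_subf; last exact: phi_continuous.
  exact: (continuous_shift (a := t *: e_ i) phi_continuous).
- exact: CcZ.
- by move=> x; exact: chi_step.
Qed.

Let h_step (eps t : R) x : 0 < eps -> eps <= 1 -> 0 < t < s ->
  (forall i, `|h (x + t *: e_ i) - h x| <= t * (H i x + eps)) ->
  forall L, (forall i, H i x <= L) ->
  (forall e, enorm e = 1 -> (forall i, S i t x <= 0 /\
      0 <= t * e ord0 i * V (rho x) - (phi (x + t *: e_ i) - phi x) <= - S i t x) ->
    \sum_i (h (x + t *: e_ i) - h x) * (phi (x + t *: e_ i) - phi x) <=
    t ^+ 2 * (V (rho x) * Hn x + n%:R * eps * V (rho x)) +
    (L + 1) * t * \sum_i - S i t x).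
Proof.
move=> e0 e1 /andP[t0 ts] hH L HL e en Se.
have Vx : 0 <= V (rho x) by exact: V_ge0.
have ei i : `|e ord0 i| <= 1.
  by rewrite -en (le_trans (normr_coord_le _ _))// normr_le_enorm.
apply: (@le_trans _ _ (\sum_i (t ^+ 2 * V (rho x) * (H i x * `|e ord0 i| + eps) +
    (L + 1) * t * - S i t x))); last first.
  rewrite big_split/= -!mulr_sumr big_split/= sumr_const card_ord lerD2r.
  have -> : t ^+ 2 * (V (rho x) * Hn x + n%:R * eps * V (rho x)) =
      t ^+ 2 * V (rho x) * (Hn x + eps *+ n) by rewrite -(mulr_natl eps); ring.
  by rewrite ler_wpM2l ?lerD2r ?Hn_ge// mulr_ge0// sqr_ge0.
apply: ler_sum => i _; have [S0 /andP[h1 h2]] := Se i.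
set a := h _ - h _; set b := phi _ - phi x in h1 h2 *.
have ha : `|a| <= t * (H i x + eps) := hH i.
(* The difference of phi is its linear part minus an error in [0, - S]. *)
have -> : a * b = a * (t * e ord0 i * V (rho x)) -
  a * (t * e ord0 i * V (rho x) - b) by ring.
apply: lerD.
  apply: le_trans (ler_norm _) _; rewrite !normrM (gtr0_norm t0) (ger0_norm Vx).
  have -> : t ^+ 2 * V (rho x) * (H i x * `|e ord0 i| + eps) =
    t * (H i x * `|e ord0 i| + eps) * (t * V (rho x)) by ring.
  rewrite [leLHS](_ : _ = `|a| * `|e ord0 i| * (t * V (rho x))); last by ring.
  apply: ler_wpM2r; first by rewrite mulr_ge0// ltW.
  apply: le_trans (ler_wpM2r (normr_ge0 _) ha) _.
  rewrite -mulrA ler_pM2l// mulrDl lerD2l.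
  by apply: ler_piMr => //; exact: ltW.
apply: le_trans (ler_norm _) _; rewrite normrN normrM (ger0_norm h1).
apply: ler_pM => //; apply: le_trans ha _; rewrite mulrC ler_pM2r//.
by rewrite lerD.
Qed.

(** The inequality [- div (V (delta) grad delta) >= B (delta)], tested against
    [h]. The sum over the axes of the integrals of [h * S] is, up to sign, the sum
    of the integrals of the products of the first differences of [h] and [phi]. It
    is bounded below by [touch]. For the upper bound, the first difference of [phi]
    is replaced by its linear part [t * e ord0 i * V], at the price of an error at
    most [- S]; the first difference of [h] being O(t), it remains to see that the
    integral of [- S] near the support of [h] is O(t ^ 2), and this follows from
    another integration by parts, against the Lipschitz cutoff [chi]. *)
Lemma weighted_L1_ineq :
  I (fun x => h x * B (clamped_depth x)) <= I (fun x => Hn x * V (clamped_depth x)).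
Proof.
have CsumH : Cc (fun x => \sum_i H i x) by exact: Cc_sum.
have [L L0 LP] := Cc_bounded CsumH.
have HL i x : H i x <= L.
  apply: le_trans (LP x); apply: le_trans (ler_norm _).
  by rewrite (bigD1 i)//= lerDl sumr_ge0.
have s_in : 0 < s < d by rewrite s_gt0 (le_lt_trans s_le).
have Vs : 0 <= V s by exact: V_ge0.
have CVchi : Cc (fun x => V (rho x) * chi x) by exact: CcMl.
have ChB : Cc (fun x => h x * B (rho x)) by exact: CcMr.
have CHV : Cc (fun x => V (rho x) * Hn x) by exact: CcMl.
pose K := I h + n%:R * I (fun x => V (rho x) * chi x) +
  (L + 1) * (n%:R * (V s / s) * I psi).
suff key (eps : R) : 0 < eps -> eps <= 1 ->
    I (fun x => h x * B (rho x)) <= I (fun x => V (rho x) * Hn x) + eps * K.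
  have -> : I (fun x => Hn x * V (clamped_depth x)) = I (fun x => V (rho x) * Hn x).
    by congr I; apply/funext => x; rewrite mulrC.
  rewrite leNgt; apply/negP; set A := I _ => BA.
  set B' := I _ in BA; pose g := B' - A; have g0 : 0 < g by rewrite subr_gt0.
  pose K' := `|K| + 1; have K'0 : 0 < K' by rewrite ltr_wpDl.
  pose eps := Num.min 1 (g / K' / 2).
  have e0 : 0 < eps by rewrite lt_min ltr01 !divr_gt0.
  have e1 : eps <= 1 by rewrite ge_min lexx.
  have := key eps e0 e1; apply/negP; rewrite -ltNge -/A -/B'.
  have eK : eps * K' <= g / 2.
    by rewrite -ler_pdivlMr// mulrAC ge_min lexx orbT.
  have : eps * K <= eps * K' by rewrite ler_pM2l// /K'; have := ler_norm K; lra.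
  rewrite /g in eK g0; lra.
move=> e0 e1.
(* All errors of one step, divided by t ^+ 2, are at most a constant times eps. *)
have [r1 r10 r1P] := touch e0.
have [r2 r20 r2P] := h_diff e0.
pose t := Num.min (Num.min (r1 / 2) (r2 / 2)) (Num.min (s / 2) eps).
have t0 : 0 < t by rewrite !lt_min !divr_gt0.
have tr1 : t < r1.
  have : t <= r1 / 2 by rewrite /t !ge_min lexx.
  lra.
have tr2 : t < r2.
  have : t <= r2 / 2 by rewrite /t !ge_min lexx !orbT.
  lra.
have ts2 : t <= s / 2 by rewrite /t !ge_min lexx !orbT.
have te : t <= eps by rewrite /t !ge_min lexx !orbT.
have ts : 0 < t < s by rewrite t0/=; lra.
have tpos : 0 < t < r1 by rewrite t0.
have t2 : 0 < t ^+ 2 by rewrite exprn_gt0.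
have V0 x : 0 <= V (rho x) by exact: V_ge0.
pose D f i x : R := f (x + t *: e_ i) - f x.
have CDh i : Cc (D h i) by apply: CcD; [exact: Cc_shift|exact: CcN].
have cDphi i : continuous (D phi i).
  apply: continuous_subf; last exact: phi_continuous.
  exact: (continuous_shift (a := t *: e_ i) phi_continuous).
have CDD i : Cc (fun x => D h i x * D phi i x) by exact: CcMr.
have ChS i : Cc (fun x => h x * S i t x) by apply: CcMr => //; exact: CS.
have CchiS i : Cc (fun x => chi x * - S i t x).
  rewrite (_ : (fun x => _) = (fun x => - (chi x * S i t x))); last first.
    by apply/funext => x; rewrite mulrN.
  by apply: CcN; apply: CcMr => //; exact: CS.
have lower : t ^+ 2 * (I (fun x => h x * B (rho x)) - eps * I h) <=
    \sum_i I (fun x => D h i x * D phi i x).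
  have -> : \sum_i I (fun x => D h i x * D phi i x) =
      I (fun x => - \sum_i h x * S i t x).
    rewrite IN ?I_sum//; last exact: Cc_sum.
    rewrite -sumrN; apply: eq_bigr => i _.
    by rewrite /S I_second_difference ?opprK.
  have C1 : Cc (fun x => (- eps) * h x) by exact: CcZ.
  rewrite -mulNr -IZ// -ID// -IZ; last exact: CcD.
  apply: I_le; [by apply/CcZ/CcD|by apply/CcN/Cc_sum|move=> x].
  have [->|hx] := eqVneq (h x) 0.
    by under eq_bigr do rewrite mul0r; rewrite mul0r mulr0 addr0 mulr0 big1 ?oppr0.
  have [dx _] := h_supp hx.
  have [|e [_ _ Sx]] := r1P t x tpos; first lra.
  rewrite -mulr_sumr -mulrN.
  have -> : t ^+ 2 * (h x * B (rho x) + - eps * h x) =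
    h x * (t ^+ 2 * (B (rho x) - eps)) by ring.
  by rewrite ler_wpM2l//; lra.
have upper : \sum_i I (fun x => D h i x * D phi i x) <=
    t ^+ 2 * (I (fun x => V (rho x) * Hn x) + n%:R * eps * I (fun x => V (rho x) * chi x)) +
    (L + 1) * t * \sum_i I (fun x => chi x * - S i t x).
  have CsumS : Cc (fun x => \sum_i chi x * - S i t x) by exact: Cc_sum.
  have C1 : Cc (fun x => n%:R * eps * (V (rho x) * chi x)) by exact: CcZ.
  have C2 : Cc (fun x => V (rho x) * Hn x + n%:R * eps * (V (rho x) * chi x)).
    exact: CcD.
  rewrite -!I_sum// -IZ// -ID// -IZ// -IZ// -ID; [|exact: CcZ|exact: CcZ].
  apply: I_le; [exact: Cc_sum|by apply: CcD; exact: CcZ|move=> x].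
  have [/allP Dh0|/allPn[i _ Dhi]] := boolP (all (fun i => D h i x == 0) (index_enum 'I_n)).
    rewrite big1 => [|i _]; last first.
      by have /eqP -> := Dh0 i (mem_index_enum i); rewrite mul0r.
    have chiS_ge0 i : 0 <= chi x * - S i t x.
      have [->|/chi_supp[dx _]] := eqVneq (chi x) 0; first by rewrite mul0r.
      by have [e [_ /(_ i)[Si _] _]] := r1P t x tpos dx; rewrite mulr_ge0// oppr_ge0.
    apply: addr_ge0; apply: mulr_ge0; rewrite ?sqr_ge0//.
    - by rewrite addr_ge0 ?mulr_ge0// ltW.
    - by rewrite mulr_ge0 ?addr_ge0// ltW.
    - exact: sumr_ge0.
  have [dx xM] : 3 * s <= depth Omega x /\ enorm x <= M + s.
    have [hx|hx] := eqVneq (h x) 0; last first.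
      by have [h1 h2] := h_supp hx; split; lra.
    have [h1 h2] : 4 * s <= depth Omega (x + t *: e_ i) /\ enorm (x + t *: e_ i) <= M.
      by apply: h_supp; move: Dhi; rewrite /D hx subr0.
    have := depth_lip (x + t *: e_ i) x; have := enorm_lipschitz (x + t *: e_ i) x.
    rewrite addrAC subrr add0r enorm_step// !ler_norml => /andP[h3 h4] /andP[h5 h6].
    by split; lra.
  have chi1 := chi_ge1 dx xM.
  have [|e [en eS _]] := r1P t x tpos; first lra.
  apply: le_trans (h_step e0 e1 ts (fun j => r2P t x j _) (fun j => HL j x) en eS) _.
    by rewrite t0.
  have nV : 0 <= n%:R * eps * V (rho x) by rewrite !mulr_ge0// ltW.
  apply: lerD.
    rewrite ler_pM2l// lerD2l mulrA -[leLHS]mulr1; exact: ler_wpM2l.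
  apply: ler_wpM2l; first by rewrite mulr_ge0 ?addr_ge0// ltW.
  apply: ler_sum => j _; have [Sj _] := eS j.
  by rewrite -[leLHS]mul1r ler_wpM2r// oppr_ge0.
have Sbound : \sum_i I (fun x => chi x * - S i t x) <=
    t ^+ 2 * (n%:R * (V s / s) * I psi).
  apply: (@le_trans _ _ (\sum_(i < n) t ^+ 2 * (V s / s) * I psi)).
    by apply: ler_sum => i _; exact: I_chi_S.
  by rewrite sumr_const card_ord -mulr_natl le_eqVlt; apply/orP; left; apply/eqP; ring.
have P0 : 0 <= (L + 1) * (n%:R * (V s / s) * I psi).
  by rewrite !mulr_ge0 ?addr_ge0 ?invr_ge0 ?I_ge0// ltW.
have LT : 0 <= (L + 1) * t by rewrite mulr_ge0 ?addr_ge0// ltW.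
have := le_trans (le_trans lower upper) (lerD (lexx _) (ler_wpM2l LT Sbound)).
set A := I _; set E := I _; set C := I _; set G := I _.
rewrite (_ : _ + _ * _ = t ^+ 2 * (C + n%:R * eps * G +
  t * ((L + 1) * (n%:R * (V s / s) * I psi)))); last by ring.
rewrite ler_pM2l//.
have := ler_wpM2r P0 te.
rewrite /K -/E -/G; set P := (L + 1) * _; lra.
Qed.

End weighted_L1.

(** * Test functions *)

Lemma near_eq_continuous (X Y : topologicalType) (f1 f : X -> Y) (x : X) :
  (\forall y \near x, f1 y = f y) -> {for x, continuous f1} -> {for x, continuous f}.
Proof.
move=> ff c; rewrite /prop_for /continuous_at -(nbhs_singleton ff).
by apply: cvg_trans c; exact: near_eq_cvg.
Qed.

Lemma is_derive_line (R : realType) (X : normedModType R) (f : X -> R) (x v : X)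
    (u df : R) : is_derive (x + u *: v) v f df ->
  is_derive u (1 : R) (fun u => f (x + u *: v)) df.
Proof.
have E : (fun h : R => h^-1 *: (f (x + (h *: (1 : R) + u) *: v) - f (x + u *: v))) =
    (fun h : R => h^-1 *: (f (h *: v + (x + u *: v)) - f (x + u *: v))).
  apply/funext => h; congr (_ *: (f _ - _)).
  by rewrite [h *: 1]mulr1 scalerDl addrCA.
by move=> [D <-]; split; rewrite /derivable /derive E.
Qed.

Lemma Cc_uniformly_continuous (R : realType) (n : nat) (f : 'rV[R]_n -> R) (e : R) :
  Cc f -> 0 < e ->
  exists2 r, 0 < r & forall x y, `|x - y| < r -> `|f x - f y| < e.
Proof.
move=> [cf [M fM]] e0.
have cK : compact [set x : 'rV[R]_n | `|x| <= M + 1] by exact: ball_compact.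
have [r r0 rP] := heine cK (fun x _ => cf x) e0.
exists (Num.min r 1); first by rewrite lt_min r0 ltr01.
move=> x y; rewrite lt_min => /andP[xr x1].
have [xM|xM] := leP `|x| (M + 1); first exact: rP.
have yM : M < `|y| by have := ler_distD 0 x y; have := lerB_dist x y; lra.
by rewrite (fM x) ?(fM y)// ?subrr ?normr0//; lra.
Qed.

Section test_function.
Variables (R : realType) (n : nat) (Omega : set 'rV[R]_n) (g : 'rV[R]_n -> R).
Hypothesis Omega_open : open Omega.
Hypothesis Omega_inradius : einradius Omega \is a fin_num.
Hypothesis gC01 : C01 Omega g.

Let supp : set 'rV[R]_n := closure (Omega `&` [set x | g x != 0]).

Let supp_compact : compact supp. Proof. by have [] := gC01. Qed.

Let supp_sub : supp `<=` Omega. Proof. by have [] := gC01. Qed.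

Definition zero_ext (f : 'rV[R]_n -> R) (x : 'rV[R]_n) : R :=
  if pselect (Omega x) then f x else 0.

Lemma zero_extE f x : Omega x -> zero_ext f x = f x.
Proof. by rewrite /zero_ext; case: pselect. Qed.

Lemma zero_ext_out f x : ~ Omega x -> zero_ext f x = 0.
Proof. by rewrite /zero_ext; case: pselect. Qed.

Let near_Omega x : Omega x -> \forall y \near x, Omega y.
Proof. by move=> Ox; exact: open_nbhs_nbhs. Qed.

Let near_supp x : ~ supp x -> \forall y \near x, ~ supp y.
Proof.
move=> sx; apply: (open_nbhs_nbhs (conj _ (sx : (~` supp) x))).
by apply: closed_openC; exact: closed_closure.
Qed.

Let g_out x : Omega x -> ~ supp x -> g x = 0.
Proof.
by move=> Ox sx; apply/eqP/negPn/negP => gx; apply: sx; apply: subset_closure.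
Qed.

Lemma grad_out x : Omega x -> ~ supp x -> grad g x = 0.
Proof.
move=> Ox sx; apply/rowP => i; rewrite !mxE -(derive_cst (0 : R) x (delta_mx ord0 i)).
apply: near_eq_derive; apply: filterS2 (near_Omega Ox) (near_supp sx) => y.
exact: g_out.
Qed.

Let supp_bounded : exists M : R, forall x, supp x -> enorm x <= M.
Proof.
have [M [_ Mb]] := compact_bounded supp_compact.
exists (n%:R * (`|M| + 1)) => x sx; apply: le_trans (enorm_le_normr x) _.
by rewrite ler_wpM2l//; apply: Mb sx; rewrite (le_lt_trans (ler_norm _))// ltrDl.
Qed.

Lemma Cc_zero_ext f : (forall x, Omega x -> {for x, continuous f}) ->
  (forall x, Omega x -> ~ supp x -> f x = 0) -> Cc (zero_ext f).
Proof.
move=> cf f0.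
have ext0 x : ~ supp x -> zero_ext f x = 0.
  by move=> sx; have [Ox|/zero_ext_out//] := pselect (Omega x); rewrite zero_extE// f0.
split => [x|].
  have [Ox|Ox] := pselect (Omega x).
    apply: (near_eq_continuous _ (cf x Ox)).
    by apply: filterS (near_Omega Ox) => y Oy; rewrite zero_extE.
  have sx : ~ supp x by move/supp_sub.
  apply: (near_eq_continuous (f1 := fun=> 0)); last exact: cst_continuous.
  by apply: filterS (near_supp sx) => y sy; rewrite ext0.
have [M MP] := supp_bounded; exists M => x Mx; apply: ext0 => /MP.
by rewrite leNgt (lt_le_trans Mx)// normr_le_enorm.
Qed.

Lemma continuous_on_Omega x : Omega x -> {for x, continuous g}.
Proof.
by move=> Ox; have [/(_ x Ox)[dg _] _ _] := gC01; exact: differentiable_continuous.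
Qed.

Lemma grad_continuous_on_Omega x : Omega x -> {for x, continuous (grad g)}.
Proof. by move=> Ox; have [/(_ x Ox)[]] := gC01. Qed.

Definition partial (i : 'I_n) : 'rV[R]_n -> R := zero_ext (fun x => grad g x ord0 i).

Definition grad_norm : 'rV[R]_n -> R := zero_ext (fun x => enorm (grad g x)).

Lemma Cc_g : Cc (zero_ext g).
Proof. by apply: Cc_zero_ext => // x Ox; exact: continuous_on_Omega. Qed.

Lemma Cc_partial i : Cc (partial i).
Proof.
apply: Cc_zero_ext => x Ox; last by move=> sx; rewrite grad_out// mxE.
apply: (@continuous_comp _ _ _ (grad g) (fun y : 'rV[R]_n => y ord0 i)).
  exact: grad_continuous_on_Omega.
exact: coord_continuous.
Qed.

Lemma Cc_grad_norm : Cc grad_norm.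
Proof.
apply: Cc_zero_ext => x Ox; last first.
  by move=> sx; rewrite grad_out// -(scale0r (0 : 'rV[R]_n)) enormZ normr0 mul0r.
apply: (@continuous_comp _ _ _ (grad g) (@enorm R n)).
  exact: grad_continuous_on_Omega.
exact: enorm_continuous.
Qed.

Lemma grad_norm_ge0 x : 0 <= grad_norm x.
Proof. by rewrite /grad_norm /zero_ext; case: pselect => //= _; exact: enorm_ge0. Qed.

Lemma partial_sum_le e x : enorm e = 1 ->
  \sum_i `|partial i x| * `|e ord0 i| <= grad_norm x.
Proof.
move=> e1; have [Ox|Ox] := pselect (Omega x); last first.
  by rewrite /grad_norm zero_ext_out// big1// => i _;
    rewrite /partial zero_ext_out// normr0 mul0r.
rewrite /grad_norm zero_extE//.
pose v : 'rV[R]_n := \row_i `|grad g x ord0 i|; pose w : 'rV[R]_n := \row_i `|e ord0 i|.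
have ev : enorm v = enorm (grad g x).
  by rewrite /enorm; congr Num.sqrt; apply: eq_bigr => i _; rewrite mxE real_normK ?num_real.
have ew : enorm w = 1.
  by rewrite -e1 /enorm; congr Num.sqrt; apply: eq_bigr => i _; rewrite mxE real_normK ?num_real.
have := dot_le v w; rewrite ev ew mulr1 /dot; apply: le_trans.
have vE i : v ord0 i = `|partial i x| by rewrite /v mxE /partial zero_extE.
have wE i : w ord0 i = `|e ord0 i| by rewrite /w mxE.
by rewrite (eq_bigr (fun i => v ord0 i * w ord0 i)) // => i _; rewrite vE wE.
Qed.

Lemma is_derive_partial i x :
  is_derive x (delta_mx ord0 i) (zero_ext g) (partial i x).
Proof.
have [Ox|Ox] := pselect (Omega x).
  apply: (near_eq_is_derive (f := g)).
    by apply: filterS (near_Omega Ox) => y Oy; rewrite zero_extE.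
  rewrite /partial zero_extE// mxE; apply: derivableP; apply: diff_derivable.
  by have [/(_ x Ox)[]] := gC01.
have sx : ~ supp x by move/supp_sub.
rewrite /partial zero_ext_out//; apply: (near_eq_is_derive (f := fun=> 0)).
  apply: filterS (near_supp sx) => y sy.
  by have [Oy|/zero_ext_out ->//] := pselect (Omega y); rewrite zero_extE// g_out.
Qed.

Lemma zero_ext_MVT i x t : 0 < t -> exists2 c, 0 < c < t &
  zero_ext g (x + t *: delta_mx ord0 i) - zero_ext g x =
  partial i (x + c *: delta_mx ord0 i) * t.
Proof.
move=> t0; pose k u := zero_ext g (x + u *: delta_mx ord0 i).
have Dk u : is_derive u (1 : R) k (partial i (x + u *: delta_mx ord0 i)).
  by apply: is_derive_line; exact: is_derive_partial.
have [|c] := @MVT R k (fun u : R => partial i (x + u *: delta_mx ord0 i)) 0 t t0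
  (fun u _ => Dk u).
- by apply: derivable_within_continuous => v _; have [] := Dk v.
by rewrite in_itv/= /k scale0r addr0 subr0 => ct E; exists c.
Qed.

(** The support is compact and the distance is positive on it. *)
Lemma support_depth : exists s M : R, [/\ 0 < s, s <= inradius Omega &
  forall x, supp x -> 4 * s <= depth Omega x /\ enorm x <= M].
Proof.
have r0 := inradius_gt0 Omega_open Omega_inradius.
have [M MP] := supp_bounded.
have [s0|sN] := pselect (supp !=set0); last first.
  by exists (inradius Omega), M; split => // x sx; exfalso; apply: sN; exists x.
have [c + cP] := EVT_min_rV s0 supp_compact
  (continuous_subspaceT (depth_continuous Omega_open Omega_inradius)).
rewrite inE => sc; have Oc := supp_sub sc.
have dc : 0 < depth Omega c by rewrite depthE//; exact: delta_gt0.
exists (Num.min (depth Omega c / 4) (inradius Omega)), M; split.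
- by rewrite lt_min r0 divr_gt0.
- by rewrite ge_min lexx orbT.
move=> x sx; split; last exact: MP.
apply: le_trans (cP x (mem_set sx)).
by rewrite mulrC -ler_pdivlMr// ge_min lexx.
Qed.

Lemma zero_ext_supp x : zero_ext g x != 0 -> supp x.
Proof.
have [Ox|/zero_ext_out->] := pselect (Omega x); last by rewrite eqxx.
by rewrite zero_extE// => gx; exact: subset_closure.
Qed.

Lemma grad_norm_supp x : grad_norm x != 0 -> supp x.
Proof.
move=> gx; apply: contrapT => sx; move: gx; rewrite /grad_norm.
have [Ox|/zero_ext_out->] := pselect (Omega x); last by rewrite eqxx.
by rewrite zero_extE// grad_out// -(scale0r (0 : 'rV[R]_n)) enormZ normr0 mul0r eqxx.
Qed.

Section power.
Variable p : R.
Hypothesis p_ge1 : 1 <= p.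

Let p_gt0 : 0 < p. Proof. exact: lt_le_trans p_ge1. Qed.

Let p1_ge0 : 0 <= p - 1. Proof. by rewrite subr_ge0. Qed.

Let g0 := zero_ext g.

Definition test x : R := `|g0 x| `^ p.

Let P x : R := `|g0 x| `^ (p - 1).

(** The mean value inequality for [t |-> t `^ p], from its tangents; it holds at 0
    also when [p = 1]. *)
Lemma powR_dist_le (a b c : R) : 0 <= a <= c -> 0 <= b <= c ->
  `|a `^ p - b `^ p| <= p * c `^ (p - 1) * `|a - b|.
Proof.
wlog ba : a b / b <= a.
  move=> H ac bc; have [ba|/ltW ab] := leP b a; first exact: H.
  by rewrite distrC (distrC a) H.
move=> /andP[a0 ac] /andP[b0 bc].
have T := powR_tangent p_ge1 a0 b0.
rewrite ger0_norm; last first.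
  by rewrite subr_ge0 ge0_ler_powR ?nnegrE// ltW.
rewrite (ger0_norm (x := a - b)) ?subr_ge0//.
apply: (@le_trans _ _ (p * a `^ (p - 1) * (a - b))); first lra.
apply: ler_wpM2r; first by rewrite subr_ge0.
apply: ler_wpM2l; first exact: ltW.
by rewrite ge0_ler_powR ?nnegrE// (le_trans a0).
Qed.

Let P_ge0 x : 0 <= P x. Proof. exact: powR_ge0. Qed.

Lemma continuous_powR_g (a : R) : 0 <= a -> continuous (fun x => `|g0 x| `^ a).
Proof.
move=> a0 x; apply: (@continuous_comp _ _ _ g0 (fun y : R => `|y| `^ a)).
  by have [cg _] := Cc_g; exact: cg.
exact: continuous_powR_norm.
Qed.

Lemma Cc_powR_g (a : R) : 0 < a -> Cc (fun x => `|g0 x| `^ a).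
Proof.
move=> a0; split; first exact/continuous_powR_g/ltW.
have [_ [M gM]] := Cc_g; exists M => x xM.
by rewrite /g0 gM// normr0 powR0// gt_eqF.
Qed.

(* For p = 1 the function P is the constant 1, which is not in Cc. *)
Let P_uniformly_continuous e : 0 < e ->
  exists2 r, 0 < r & forall x y, `|x - y| < r -> `|P x - P y| < e.
Proof.
move=> e0; have [p1|p1] := eqVneq p 1.
  by exists 1 => // x y _; rewrite /P p1 subrr !powRr0 subrr normr0.
apply: Cc_uniformly_continuous => //; apply: Cc_powR_g.
by rewrite subr_gt0 lt_def p1.
Qed.

Let P_bounded : exists2 K, 0 <= K & forall x, P x <= K.
Proof.
have [p1|p1] := eqVneq p 1.
  by exists 1 => // x; rewrite /P p1 subrr powRr0.
have [|K K0 KP] := @Cc_bounded R n P; last first.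
  by exists K => // x; exact: le_trans (ler_norm _) (KP x).
by apply: Cc_powR_g; rewrite subr_gt0 lt_def p1.
Qed.

Lemma Cc_test : Cc test.
Proof. exact: Cc_powR_g. Qed.

Definition test_partial i x : R := p * (P x * `|partial i x|).

Definition test_grad x : R := p * (P x * grad_norm x).

Lemma Cc_test_partial i : Cc (test_partial i).
Proof.
apply: CcZ; apply: CcMl; last exact: continuous_powR_g.
have [c [M pM]] := Cc_partial i; split.
  move=> x; apply: (@continuous_comp _ _ _ (partial i) (fun y : R => `|y|)).
    exact: c.
  exact: norm_continuous.
by exists M => x xM; rewrite pM// normr0.
Qed.

Lemma Cc_test_grad : Cc test_grad.
Proof.
apply: CcZ; apply: CcMl; first exact: Cc_grad_norm.
exact: continuous_powR_g.
Qed.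

Lemma test_partial_sum_le e x : enorm e = 1 ->
  \sum_i test_partial i x * `|e ord0 i| <= test_grad x.
Proof.
move=> e1; rewrite /test_partial /test_grad.
under eq_bigr do rewrite mulrA -mulrA.
by rewrite -mulr_sumr mulrA ler_wpM2l ?mulr_ge0 ?partial_sum_le// ltW.
Qed.

(** For [p = 1] the function [test] need not be differentiable, but its difference
    quotients are still controlled by the gradient of [g], uniformly because [P] and
    the partial derivatives of [g] are uniformly continuous. *)
Lemma test_diff eps : 0 < eps -> exists2 r, 0 < r & forall t x i, 0 < t < r ->
  `|test (x + t *: delta_mx ord0 i) - test x| <= t * (test_partial i x + eps).
Proof.
move=> eps0.
have [KP KP0 KPP] := P_bounded.
have CsumD : Cc (fun x => \sum_i `|partial i x|).
  apply: Cc_sum => i; have [c [M pM]] := Cc_partial i; split.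
    move=> x; apply: (@continuous_comp _ _ _ (partial i) (fun y : R => `|y|)).
      exact: c.
    exact: norm_continuous.
  by exists M => x xM; rewrite pM// normr0.
have [KD KD0 KDP] := Cc_bounded CsumD.
have DK i x : `|partial i x| <= KD.
  apply: le_trans (KDP x); apply: le_trans (ler_norm _).
  by rewrite (bigD1 i)//= lerDl sumr_ge0.
pose N := p * (KP + KD + 1); have N0 : 0 < N by rewrite mulr_gt0//; lra.
pose eta := Num.min 1 (eps / N).
have eta0 : 0 < eta by rewrite lt_min ltr01 divr_gt0.
have eta1 : eta <= 1 by rewrite ge_min lexx.
have etaN : N * eta <= eps by rewrite mulrC -ler_pdivlMr// ge_min lexx orbT.
have [r1 r10 r1P] := P_uniformly_continuous eta0.
have rD : exists2 r, 0 < r & forall i x y, `|x - y| < r ->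
    `|partial i x - partial i y| < eta.
  have rDi i : exists r, 0 < r /\ forall x y, `|x - y| < r ->
      `|partial i x - partial i y| < eta.
    by have [r ? ?] := Cc_uniformly_continuous (Cc_partial i) eta0; exists r.
  have [f fP] := choice rDi.
  exists (\big[Num.min/1]_i f i).
    by apply: lt_bigmin => // i _; have [] := fP i.
  move=> i x y xy; have [_] := fP i; apply; apply: lt_le_trans xy _.
  exact: bigmin_le.
have [r2 r20 r2P] := rD.
exists (Num.min r1 r2); first by rewrite lt_min r10.
move=> t x i; rewrite lt_min => /andP[t0 /andP[tr1 tr2]].
set x' := x + _.
have [c /andP[c0 ct] E] := zero_ext_MVT i x t0.
have step u : 0 < u -> u <= t -> `|x - (x + u *: delta_mx ord0 i)| <= t.
  move=> u0 ut; rewrite opprD addrA subrr add0r normrN.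
  by apply: le_trans (normr_le_enorm _) _; rewrite enormZ enorm_delta mulr1 gtr0_norm.
pose b := Num.max `|g0 x'| `|g0 x|.
have bP : b `^ (p - 1) <= P x + eta.
  rewrite /b maxEle; case: ifP => _; first by rewrite -/(P x) lerDl ltW.
  have := r1P x x' (le_lt_trans (step t t0 (lexx _)) tr1).
  by rewrite ltr_norml -/(P x') => /andP[]; lra.
apply: le_trans (powR_dist_le (c := b) _ _) _.
- by rewrite normr_ge0 /b le_max lexx.
- by rewrite normr_ge0 /b le_max lexx orbT.
have D1 : `| `|g0 x'| - `|g0 x| | <= t * (`|partial i x| + eta).
  apply: le_trans (ler_dist_dist _ _) _; rewrite E normrM (gtr0_norm t0) mulrC.
  rewrite ler_pM2l//.
  have := r2P i x _ (le_lt_trans (step c c0 (ltW ct)) tr2).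
  set q := partial i (x + _) => xq; have := ler_normB (partial i x) (partial i x - q).
  by rewrite opprB addrC subrK; lra.
apply: (@le_trans _ _ (p * (P x + eta) * (t * (`|partial i x| + eta)))).
  apply: ler_pM => //; first by rewrite mulr_ge0 ?powR_ge0// ltW.
  by rewrite ler_wpM2l// ltW.
have -> : p * (P x + eta) * (t * (`|partial i x| + eta)) =
  t * (test_partial i x + p * (P x + `|partial i x| + eta) * eta).
  by rewrite /test_partial; ring.
rewrite ler_pM2l// lerD2l; apply: le_trans etaN.
rewrite ler_pM2r// /N ler_pM2l//.
by have := KPP x; have := DK i x; lra.
Qed.

End power.

End test_function.
(** * The inequalities *)

Lemma nu_m_bounds (R : realType) (m nu : R) :
  1 < m -> 0 <= nu <= 1 / m -> 0 <= nu * m <= 1.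
Proof.
move=> m1 /andP[nu0]; have m0 : 0 < m := lt_trans ltr01 m1.
by rewrite ler_pdivlMr// => ->; rewrite mulr_ge0// ltW.
Qed.

Lemma gradient_coef_gt0 (R : realType) (m nu lambda : R) :
  1 < m -> 0 <= nu <= 1 / m -> 0 <= lambda < (1 + nu * m) / 2 ->
  0 < 2 * (1 + nu * m) - 4 * lambda ^+ 2.
Proof.
move=> m1 /(nu_m_bounds m1); set r := nu * m => /andP[r0 r1] /andP[l0 l1].
by nra.
Qed.

Lemma continuous_weight (R : realType) (a b q u : R) : 0 < u ->
  {for u, continuous (fun u : R => a / u ^+ 2 + b / u `^ q)}.
Proof.
move=> u0; have uN : u != 0 by rewrite gt_eqF.
apply: cvgD; (apply: cvgM; first exact: cvg_cst); apply: cvgV.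
- by rewrite expf_neq0.
- by apply: cvgM; exact: cvg_id.
- by rewrite gt_eqF// powR_gt0.
- exact: continuous_powR_pos.
Qed.

(** The four integrals of the proof, written with [clamped_depth] in place of
    [delta]: the two agree on the support of [g], and the weights become continuous
    on the whole space. *)
Section integrals.
Variables (R : realType) (n : nat) (Omega : set 'rV[R]_n) (g : 'rV[R]_n -> R).
Variables (p s M : R).
Hypothesis Omega_open : open Omega.
Hypothesis Omega_convex : convex_set (Omega : set (convex_lmodType 'rV[R]_n)).
Hypothesis Omega_inradius : einradius Omega \is a fin_num.
Hypothesis gC01 : C01 Omega g.
Hypothesis p_ge1 : 1 <= p.
Hypothesis s_gt0 : 0 < s.
Hypothesis s_le : s <= inradius Omega.
Hypothesis suppP : forall x, closure (Omega `&` [set x | g x != 0]) x ->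
  4 * s <= depth Omega x /\ enorm x <= M.

Let p_gt0 : 0 < p. Proof. exact: lt_le_trans p_ge1. Qed.

Let pN : p != 0. Proof. by rewrite gt_eqF. Qed.

Let cd := clamped_depth Omega s.

Let cd_gt0 x : 0 < cd x. Proof. by rewrite /cd /clamped_depth lt_max s_gt0 orbT. Qed.

Let cdE x : Omega x -> closure (Omega `&` [set x | g x != 0]) x -> cd x = delta Omega x.
Proof.
move=> Ox /suppP[dx _]; rewrite -depthE// /cd /clamped_depth; apply/max_idPl.
by apply: le_trans dx; rewrite ler_peMl// ?ltW// ltr1n.
Qed.

Let gn := grad_norm Omega g.

Let gn_ge0 x : 0 <= gn x. Proof. exact: grad_norm_ge0. Qed.

Definition hardy_term : R := I (fun x => test Omega g p x * (cd x ^+ 2)^-1).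

Definition power_term (q : R) : R := I (fun x => test Omega g p x * (cd x `^ q)^-1).

Definition gradient_term : R := I (fun x => gn x `^ p * (cd x `^ (2 - p))^-1).

Definition mixed_term : R := I (fun x => test_grad Omega g p x * (cd x)^-1).

Let continuous_cd (f : R -> R) :
  (forall u : R, 0 < u -> {for u, continuous f}) -> continuous (fun x => f (cd x)).
Proof.
move=> cf; have d_gt : inradius Omega < inradius Omega + 1 by rewrite ltrDl.
apply: (continuous_comp_depth Omega_open Omega_inradius d_gt s_gt0 s_le).
by move=> u /andP[u0 _]; exact: cf.
Qed.

Let continuous_cd_sqr : continuous (fun x => (cd x ^+ 2)^-1).
Proof.
apply: (continuous_cd (f := fun u : R => (u ^+ 2)^-1)) => u u0; apply: cvgV.
  by rewrite expf_neq0// gt_eqF.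
by apply: cvgM; exact: cvg_id.
Qed.

Let continuous_cd_powR q : continuous (fun x => (cd x `^ q)^-1).
Proof.
apply: (continuous_cd (f := fun u : R => (u `^ q)^-1)) => u u0; apply: cvgV.
  by rewrite gt_eqF// powR_gt0.
exact: continuous_powR_pos.
Qed.

Let continuous_cd_inv : continuous (fun x => (cd x)^-1).
Proof.
apply: (continuous_cd (f := fun u : R => u^-1)) => u u0; apply: cvgV.
  by rewrite gt_eqF.
exact: cvg_id.
Qed.

Let Ctest := Cc_test Omega_open gC01 p_ge1.

Let Chardy : Cc (fun x => test Omega g p x * (cd x ^+ 2)^-1).
Proof. exact: CcMr. Qed.

Let Cpower q : Cc (fun x => test Omega g p x * (cd x `^ q)^-1).
Proof. exact: CcMr. Qed.

Let Cgn : Cc (fun x => gn x `^ p).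
Proof.
have [c [N gN]] := Cc_grad_norm Omega_open gC01; split; last first.
  by exists N => x xN; rewrite /gn gN// powR0.
rewrite (_ : (fun x => _) = (fun x => `|gn x| `^ p)); last first.
  by apply/funext => x; rewrite ger0_norm.
move=> x; apply: (@continuous_comp _ _ _ gn (fun y : R => `|y| `^ p)); first exact: c.
by apply: continuous_powR_norm; exact: ltW.
Qed.

Let Cgradient : Cc (fun x => gn x `^ p * (cd x `^ (2 - p))^-1).
Proof. exact: CcMr. Qed.

Let Cmixed : Cc (fun x => test_grad Omega g p x * (cd x)^-1).
Proof. exact: (CcMr (Cc_test_grad Omega_open gC01 p_ge1)). Qed.

Let integral_Omega (f F : 'rV[R]_n -> R) : Cc F -> (forall x, Omega x -> f x = F x) ->
  (forall x, ~ Omega x -> F x = 0) ->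
  (\int[lebesgue_rV R n]_(x in Omega) (f x)%:E = (I F)%:E)%E.
Proof.
move=> CF fF F0; rewrite integral_mkcond -I_EFin//; congr integral.
apply/funext => x; rewrite patchE; case: ifPn; rewrite ?inE ?notin_setE.
  by move/fF => ->.
by move/F0 => ->.
Qed.

Let test_out x : ~ Omega x -> test Omega g p x = 0.
Proof. by move=> Ox; rewrite /test zero_ext_out// normr0 powR0. Qed.

Let test_frac (f : R -> R) x : Omega x ->
  `|g x| `^ p / f (delta Omega x) = test Omega g p x * (f (cd x))^-1.
Proof.
move=> Ox; have [g0|gN] := eqVneq (g x) 0.
  by rewrite /test zero_extE// g0 normr0 powR0// !mul0r.
by rewrite /test zero_extE// cdE//; exact: subset_closure.
Qed.

Lemma hardy_termE : (\int[lebesgue_rV R n]_(x in Omega)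
  (`|g x| `^ p / delta Omega x ^+ 2)%:E = hardy_term%:E)%E.
Proof.
apply: integral_Omega => // [x Ox|x Ox]; last by rewrite test_out// mul0r.
exact: (test_frac (fun u => u ^+ 2)).
Qed.

Lemma power_termE q : (\int[lebesgue_rV R n]_(x in Omega)
  (`|g x| `^ p / delta Omega x `^ q)%:E = (power_term q)%:E)%E.
Proof.
apply: integral_Omega => // [x Ox|x Ox]; last by rewrite test_out// mul0r.
exact: (test_frac (fun u => u `^ q)).
Qed.

Lemma gradient_termE : (\int[lebesgue_rV R n]_(x in Omega)
  (enorm (grad g x) `^ p / delta Omega x `^ (2 - p))%:E = gradient_term%:E)%E.
Proof.
apply: integral_Omega => // x Ox; last first.
  by rewrite /gn /grad_norm zero_ext_out// powR0// mul0r.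
have E : gn x = enorm (grad g x) by rewrite /gn /grad_norm zero_extE.
rewrite -E; have [->|gN] := eqVneq (gn x) 0; first by rewrite powR0// !mul0r.
by rewrite cdE//; exact: (grad_norm_supp Omega_open).
Qed.

(** The L^1 inequality for [|g|^p], with the bound [V <= C / s] inserted. *)
Lemma hardy_L1 (W V : R -> R) (A c C q d : R) : inradius Omega < d ->
  0 <= A -> 0 <= c ->
  (forall u : R, 0 < u < d -> [/\ is_derive u (1 : R) W (V u), 0 <= V u <= C / u &
     exists2 dV, is_derive u (1 : R) V dV & dV <= - (A / u ^+ 2 + c / u `^ q)]) ->
  A * hardy_term + c * power_term q <= C * mixed_term.
Proof.
move=> d_gt A0 c0 WV.
have cd_lt x : 0 < cd x < d.
  rewrite cd_gt0/= /cd /clamped_depth gt_max (le_lt_trans s_le d_gt) andbT.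
  exact: le_lt_trans (depth_le_inradius Omega_open Omega_inradius x) d_gt.
have test0 x : 0 <= test Omega g p x by exact: powR_ge0.
have P0 x : 0 <= test_grad Omega g p x.
  by rewrite /test_grad mulr_ge0 ?mulr_ge0 ?powR_ge0// ltW.
have := @weighted_L1_ineq R n Omega Omega_open Omega_convex Omega_inradius W V
  (fun u => A / u ^+ 2 + c / u `^ q) d d_gt _ _ _ _ _ s s_gt0 s_le (test Omega g p)
  (test_grad Omega g p) (test_partial Omega g p) M Ctest _ _
  (Cc_test_partial Omega_open gC01 p_ge1) _ (Cc_test_grad Omega_open gC01 p_ge1) P0 _
  (fun eps => @test_diff R n Omega g Omega_open gC01 p p_ge1 eps).
have E : I (fun x => test Omega g p x * (A / cd x ^+ 2 + c / cd x `^ q)) =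
    A * hardy_term + c * power_term q.
  rewrite -IZ// -IZ// -ID; [|exact: CcZ|exact: CcZ].
  by congr I; apply/funext => x; ring.
rewrite E => H; apply: (@le_trans _ _ (I (fun x => test_grad Omega g p x * V (cd x)))).
  apply: H => //.
  - by move=> u /WV[].
  - by move=> u /WV[_ /andP[]].
  - by move=> u /WV[].
  - move=> u /andP[u0 _].
    by rewrite addr_ge0// divr_ge0// ?exprn_ge0 ?powR_ge0// ltW.
  - by move=> u /andP[u0 _]; exact: continuous_weight.
  - move=> x hx; apply: suppP; apply: zero_ext_supp.
    by apply: contra_neq hx => g0; rewrite /test g0 normr0 powR0.
  - by move=> i x; rewrite /test_partial mulr_ge0 ?mulr_ge0 ?powR_ge0// ltW.
  - by move=> e x e1; exact: test_partial_sum_le.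
rewrite -IZ//; apply: I_le; last first.
- move=> x; rewrite mulrCA ler_wpM2l//.
  by have [_ /andP[]] := WV _ (cd_lt x).
- exact: CcZ.
apply: (CcMr (Cc_test_grad Omega_open gC01 p_ge1)).
apply: (continuous_comp_depth Omega_open Omega_inradius d_gt s_gt0 s_le) => u /WV[_ _ [dV DV _]].
exact: is_derive_continuous_at DV.
Qed.

(** Young's inequality between [|g|] and [K * delta * |grad g|], divided by
    [delta ^+ 2] and integrated. *)
Lemma mixed_term_le (K : R) : 0 <= K ->
  K * mixed_term <= (p - 1) * hardy_term + K `^ p * gradient_term.
Proof.
move=> K0; rewrite -!IZ// -ID; [|exact: CcZ|exact: CcZ].
apply: I_le; first exact: CcZ.
  by apply: CcD; exact: CcZ.
move=> x; rewrite /test_grad /test -/gn.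
have a0 := normr_ge0 (zero_ext Omega g x); set a := `|_| in a0 *.
have c0 := cd_gt0 x; set c := cd x in c0 *.
have := gn_ge0 x; set G := gn x => G0.
have b0 : 0 <= K * (c * G) by rewrite mulr_ge0// mulr_ge0// ltW.
have := powR_tangent p_ge1 a0 b0.
rewrite !powRM ?mulr_ge0// ?(ltW c0)//.
have := mulr_powRB1 a0 p_gt0.
set u := a `^ (p - 1); set U := a `^ p; set X := G `^ p; set L := K `^ p => uU.
have -> : c `^ (2 - p) = c ^+ 2 / c `^ p.
  have cN : c != 0 by rewrite gt_eqF.
  by rewrite (@powRD _ c 2 (- p)) ?cN ?implybT// powRN powR_mulrn// ltW.
have : c `^ p != 0 by rewrite gt_eqF// powR_gt0.
set k := c `^ p => kN H.
rewrite -(ler_pM2r (x := c ^+ 2)) ?exprn_gt0//.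
have -> : K * (p * (u * G) * c^-1) * c ^+ 2 = p * u * (K * (c * G) - a) + p * U.
  by rewrite -uU; field; rewrite gt_eqF.
have -> : ((p - 1) * (U * (c ^+ 2)^-1) + L * (X * (c ^+ 2 / k)^-1)) * c ^+ 2 =
    (p - 1) * U + L * (k * X).
  by field; rewrite kN gt_eqF.
by move: H; lra.
Qed.

(** The weight of [hardy_weight] lives on [0 < s < d] with [d] above the inradius;
    both sides are continuous in [d]. *)
Lemma hardy_inradius (m nu lambda : R) :
  1 < m -> 0 <= nu <= 1 / m -> 0 <= lambda < (1 + nu * m) / 2 ->
  (1 - nu ^+ 2 * m ^+ 2) * hardy_term +
  4 * (bessel_c nu m lambda ^+ 2 + (m - 1) * (lambda - lambda ^+ 2)) / inradius Omega `^ m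
    * power_term (2 - m)
  <= (2 * (1 + nu * m) - 4 * lambda ^+ 2) * mixed_term.
Proof.
move=> m1 nuP laP; have m0 : 0 < m by lra.
have numP := nu_m_bounds m1 nuP.
set b := 4 * _; set A := 1 - _; set C := 2 * _ - _.
have A0 : 0 <= A by rewrite /A -exprMn; set r := nu * m in numP *; nra.
have b0 : 0 <= b.
  rewrite /b; set c2 := bessel_c _ _ _; have := sqr_ge0 c2; set r := nu * m in numP laP *.
  have : 0 <= (m - 1) * (lambda - lambda ^+ 2) by apply: mulr_ge0; nra.
  lra.
have i0 := inradius_gt0 Omega_open Omega_inradius.
pose T := C * mixed_term - A * hardy_term.
have H d : inradius Omega < d -> b * power_term (2 - m) <= T * d `^ m.
  move=> d_gt; have d0 : 0 < d := lt_trans i0 d_gt.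
  have [W [V WV]] := hardy_weight m1 nuP laP d0.
  have dm : 0 < d `^ m by rewrite powR_gt0.
  have bd : 0 <= b / d `^ m by rewrite divr_ge0// ltW.
  have := hardy_L1 d_gt A0 bd WV.
  rewrite -lerBrDl -/T mulrAC ler_pdivrMr//.
suff : b * power_term (2 - m) <= T * inradius Omega `^ m.
  rewrite -ler_pdivrMr ?powR_gt0// mulrAC /T; lra.
have cT : (fun d : R => T * d `^ m) d @[d --> (inradius Omega)^'+] --> T * inradius Omega `^ m.
  apply: cvgM; first exact: cvg_cst.
  by apply: cvg_at_right_filter; exact: continuous_powR_pos.
apply: cvgr_to_ge cT _.
by near=> d; apply: H; near: d; exact: nbhs_right_gt.
Unshelve. all: by end_near. Qed.

(** From the L^1 inequality to the exponent [p]: the summand [(p - 1) * hardy_term]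
    that Young's inequality leaves is absorbed on the left. *)
Lemma hardy_Lp (a c K q : R) : 0 <= K ->
  a * hardy_term + c * power_term q <= K * mixed_term ->
  (p * a - (p - 1)) * hardy_term + p * c * power_term q <=
  p `^ p * K `^ p * gradient_term.
Proof.
move=> K0 H; have pK0 : 0 <= p * K by rewrite mulr_ge0// ltW.
have := mixed_term_le pK0; rewrite powRM ?(ltW p_gt0)//.
move: H; rewrite -(ler_pM2l p_gt0); lra.
Qed.

End integrals.

Theorem theorem6 (R : realType) (n : nat) (Omega : set 'rV[R]_n)
    (p : R) (g : 'rV[R]_n -> R)
    (Omega_open : open Omega)
    (Omega_convex : convex_set (Omega : set (convex_lmodType 'rV[R]_n)))
    (Omega_inradius : einradius Omega \is a fin_num)
    (p_ge1 : 1 <= p)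
    (gC01 : C01 Omega g) :
  (forall m nu lambda : R,
    1 < m -> 0 <= nu <= 1 / m -> 0 <= lambda < (1 + nu * m) / 2 ->
    ((1 - p * nu ^+ 2 * m ^+ 2)%:E *
       \int[lebesgue_rV R n]_(x in Omega) (`|g x| `^ p / delta Omega x ^+ 2)%:E +
     (4 * p * (bessel_c nu m lambda ^+ 2 + (m - 1) * (lambda - lambda ^+ 2))
        / inradius Omega `^ m)%:E *
       \int[lebesgue_rV R n]_(x in Omega)
         (`|g x| `^ p / delta Omega x `^ (2 - m))%:E
     <= (p `^ p * (2 * (1 + nu * m) - 4 * lambda ^+ 2) `^ p)%:E *
       \int[lebesgue_rV R n]_(x in Omega)
         (enorm (grad g x) `^ p / delta Omega x `^ (2 - p))%:E)%E)
  /\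
  (forall m nu lambda : R,
    1 < m -> 0 <= nu < 1 / m -> 0 <= lambda < (1 + nu * m) / 2 ->
    (\int[lebesgue_rV R n]_(x in Omega) (`|g x| `^ p / delta Omega x ^+ 2)%:E +
     (4 * p * (bessel_c nu m lambda ^+ 2 + (m - 1) * (lambda - lambda ^+ 2))
        / ((1 - nu ^+ 2 * m ^+ 2) * inradius Omega `^ m))%:E *
       \int[lebesgue_rV R n]_(x in Omega)
         (`|g x| `^ p / delta Omega x `^ (2 - m))%:E
     <= (p `^ p *
         (2 / (1 - nu * m) - 4 * lambda ^+ 2 / (1 - nu ^+ 2 * m ^+ 2)) `^ p)%:E *
       \int[lebesgue_rV R n]_(x in Omega)
         (enorm (grad g x) `^ p / delta Omega x `^ (2 - p))%:E)%E).
Proof.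
have [s [M [s0 sle suppP]]] := support_depth Omega_open Omega_inradius gC01.
have i0 := inradius_gt0 Omega_open Omega_inradius.
pose hardy := hardy_inradius Omega_open Omega_convex Omega_inradius gC01 p_ge1 s0 sle suppP.
pose Lp := hardy_Lp Omega_open Omega_inradius gC01 p_ge1 s0 sle.
split => m nu lambda m1 nuP laP;
  rewrite (hardy_termE Omega_open Omega_inradius gC01 p_ge1 s0 sle suppP)
    (power_termE Omega_open Omega_inradius gC01 p_ge1 s0 sle suppP)
    (gradient_termE Omega_open Omega_inradius gC01 p_ge1 s0 sle suppP)
    -!EFinM -EFinD lee_fin.
  have := Lp _ _ _ _ (ltW (gradient_coef_gt0 m1 nuP laP)) (hardy _ _ _ m1 nuP laP).
  apply: le_trans; rewrite le_eqVlt; apply/orP; left; apply/eqP.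
  by congr (_ * _ + _ * _); ring.
have {}nuP' : 0 <= nu <= 1 / m by case/andP: nuP => -> /ltW.
have m0 : 0 < m := lt_trans ltr01 m1.
have nm : 0 <= nu * m < 1.
  by case/andP: nuP => nu0; rewrite ltr_pdivlMr// => ->; rewrite mulr_ge0// ltW.
have A0 : 0 < 1 - nu ^+ 2 * m ^+ 2.
  by rewrite -exprMn; set r := nu * m in nm *; nra.
have K0 := gradient_coef_gt0 m1 nuP' laP.
have KE : 2 / (1 - nu * m) - 4 * lambda ^+ 2 / (1 - nu ^+ 2 * m ^+ 2) =
    (2 * (1 + nu * m) - 4 * lambda ^+ 2) / (1 - nu ^+ 2 * m ^+ 2).
  have : 1 - nu * m != 0 by rewrite subr_eq0 gt_eqF//; case/andP: nm.
  by have := lt0r_neq0 A0; rewrite -exprMn => AN BN; field; rewrite BN AN.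
rewrite KE.
(* For part (ii), the L^1 inequality is divided by A before the passage to p. *)
have := hardy _ _ _ m1 nuP' laP.
rewrite -(ler_pM2r (x := (1 - nu ^+ 2 * m ^+ 2)^-1)) ?invr_gt0// mulrDl.
set h := hardy_term _ _ _ _; set q := power_term _ _ _ _ _; set k := mixed_term _ _ _ _.
set A := 1 - nu ^+ 2 * m ^+ 2 in A0 *; set C := 2 * (1 + _) - _ in K0 *.
have AN := lt0r_neq0 A0; have IN : inradius Omega `^ m != 0 by rewrite gt_eqF// powR_gt0.
set b := 4 * _; have -> : A * h / A + b / inradius Omega `^ m * q / A =
   1 * h + b / (A * inradius Omega `^ m) * q by field; rewrite AN IN.
rewrite [C * k / A]mulrAC => /(Lp _ _ _ _ (ltW (divr_gt0 K0 A0))).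
apply: le_trans; rewrite le_eqVlt; apply/orP; left; apply/eqP.
by rewrite -/h -/q /b; field; rewrite AN IN.
Qed.
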